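(* Let $H\in(0,1)$, let $d\in\mathbb{N}$ with $d>1/H$, let $x\in\mathbb{R}^d$, and let $B^H$ be a $d$-dimensional fractional Brownian motion with Hurst parameter $H$. Then for any non-negative $f\in CL(\mathbb{R}^d)$ the perpetual integral functional $\int_0^\infty f(x+B^H(t))\,dt$ exists (is finite) almost surely, and its expectation equals $$E\left[\int_0^\infty f(x+B^H(t))\,dt\right]=C_{d,H}\int_{\mathbb{R}^d}\frac{f(x+y)}{|y|^{d-1/H}}\,dy,$$ where $$C_{d,H}=2^{-(1+1/(2H))}H^{-1}\pi^{-d/2}\,\Gamma\left(\frac d2-\frac1{2H}\right).$$ Moreover, if $f$ is not identically zero, then $\int_0^\infty f(x+B^H(t))\,dt$ is a non-constant random variable (it is not almost surely equal to a constant); consequently, for $f\neq 0$ the variance of $\int_0^\infty f(x+B^H(t))\,dt$ is strictly positive.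
   Context: $CL(\mathbb{R}^d)$ denotes the set of functions $f:\mathbb{R}^d\to\mathbb{R}$ that are continuous, bounded and belong to $L_1(\mathbb{R}^d)$ (Lebesgue measure). $|\cdot|$ is the Euclidean norm and $\Gamma$ is the Gamma function. A $d$-dimensional fractional Brownian motion with Hurst parameter $H\in(0,1)$ is $B^H(t)=(B_1^H(t),\ldots,B_d^H(t))$, $t\ge 0$, where the coordinates $B_i^H$ are independent one-dimensional fractional Brownian motions, i.e. centered Gaussian processes (with continuous paths) with covariance $E[B_i^H(t)B_i^H(s)]=\frac12\left(t^{2H}+s^{2H}-|t-s|^{2H}\right)$. The variance of a random variable $Y$ with finite mean is $E[(Y-E[Y])^2]$. *)

(* Defs.v *)
From HB Require Import structures.
From mathcomp Require Import all_boot all_order all_algebra.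
From mathcomp Require Import all_classical all_reals all_analysis.

Set Implicit Arguments.
Unset Strict Implicit.
Unset Printing Implicit Defensive.

Import Order.TTheory GRing.Theory Num.Theory.
Import numFieldNormedType.Exports.

Local Open Scope classical_set_scope.
Local Open Scope ring_scope.

(* 'rV[R]_n carries the sigma-algebra generated by its coordinates, just as
   the library does for n.-tuple R; it is the Borel sigma-algebra of R^n. *)
Section measurable_rV.
Context (R : realType) (n : nat).

Definition rV_coord (i : 'I_n) (v : 'rV[R]_n) : R := v ord0 i.

Let rV_set0 : g_sigma_preimage rV_coord set0.
Proof. exact: sigma_algebra0. Qed.

Let rV_setC A : g_sigma_preimage rV_coord A -> g_sigma_preimage rV_coord (~` A).
Proof. exact: sigma_algebraC. Qed.

Let rV_bigcup (F : (set 'rV[R]_n)^nat) :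
  (forall i, g_sigma_preimage rV_coord (F i)) ->
  g_sigma_preimage rV_coord (\bigcup_i (F i)).
Proof. exact: sigma_algebra_bigcup. Qed.

HB.instance Definition _ := @isMeasurable.Build
  (measure_tuple_display default_measure_display) 'rV[R]_n
  (g_sigma_preimage rV_coord) rV_set0 rV_setC rV_bigcup.

End measurable_rV.

Lemma measurable_rV_coord (R : realType) (n : nat) (i : 'I_n) :
  measurable_fun [set: 'rV[R]_n] (rV_coord i).
Proof.
move=> _ Y mY; rewrite setTI; apply: sub_sigma_algebra => /=.
rewrite -bigcup_seq/=; exists i => /=; first by rewrite mem_index_enum.
by exists Y => //; rewrite setTI.
Qed.

Lemma measurable_fun_rVP (R : realType) (n : nat) (d : measure_display)
    (T : measurableType d) (f : T -> 'rV[R]_n) :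
  (forall i, measurable_fun setT (fun w => f w ord0 i)) -> measurable_fun setT f.
Proof.
move=> mf.
have sub : g_sigma_preimage (fun i => rV_coord i \o f) `<=` measurable.
  apply: smallest_sub; first exact: sigma_algebra_measurable.
  case: n => [|n] in f mf *; first by rewrite big_ord0.
  rewrite -bigcup_mkord_ord; apply: bigcup_sub => i Ii.
  by move=> A [B mB <-]; exact: mf.
move=> _ A mA; apply: sub; rewrite g_sigma_preimage_comp.
by exists A.
Qed.

Section lebesgue_rV.
Context (R : realType).

Section cons.
Context (n : nat).
Variable mu : {sigma_finite_measure set 'rV[R]_n -> \bar R}.

Definition rV_cons (p : R * 'rV[R]_n) : 'rV[R]_n.+1 :=
  \row_(i < n.+1) oapp (p.2 ord0) p.1 (unlift ord0 i).

Definition rV_uncons (v : 'rV[R]_n.+1) : R * 'rV[R]_n :=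
  (v ord0 ord0, \row_(i < n) v ord0 (lift ord0 i)).

Lemma rV_cons0 p : rV_cons p ord0 ord0 = p.1.
Proof. by rewrite mxE unlift_none. Qed.

Lemma rV_consS p i : rV_cons p ord0 (lift ord0 i) = p.2 ord0 i.
Proof. by rewrite mxE liftK. Qed.

Lemma rV_consK : cancel rV_cons rV_uncons.
Proof.
move=> [x v]; rewrite /rV_uncons rV_cons0; congr pair.
by apply/rowP => i; rewrite mxE rV_consS.
Qed.

Lemma measurable_rV_cons : measurable_fun setT rV_cons.
Proof.
apply: measurable_fun_rVP => i; have [j ->|->] := unliftP ord0 i.
  under eq_fun do rewrite rV_consS.
  exact: (measurableT_comp (measurable_rV_coord j)).
under eq_fun do rewrite rV_cons0.
exact: measurable_fst.
Qed.

Lemma measurable_rV_uncons : measurable_fun setT rV_uncons.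
Proof.
apply/measurable_fun_pairP; split; first exact: (measurable_rV_coord ord0).
apply: measurable_fun_rVP => i.
under eq_fun do rewrite mxE.
exact: (measurable_rV_coord (lift ord0 i)).
Qed.

Definition lebesgue_cons : set 'rV[R]_n.+1 -> \bar R :=
  pushforward (@lebesgue_measure R \x mu)%E rV_cons.

HB.instance Definition _ := Measure.copy lebesgue_cons
  (measure_function_pushforward__canonical__measure_function_Measure
     (@lebesgue_measure R \x mu)%E measurable_rV_cons).

Let lebesgue_cons_sigma_finite : sigma_finite setT lebesgue_cons.
Proof.
have /sigma_finiteP[F [FT ndF Foo]] := sigma_finiteT (@lebesgue_measure R).
have /sigma_finiteP[G [GT ndG Goo]] := sigma_finiteT mu.
exists (fun k => rV_uncons @^-1` (F k `*` G k)) => [|k].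
  apply/seteqP; split => [v _|//].
  have [i _ Fi] : (\bigcup_k F k) (rV_uncons v).1 by rewrite -FT.
  have [j _ Gj] : (\bigcup_k G k) (rV_uncons v).2 by rewrite -GT.
  exists (maxn i j) => //; split.
    by move: Fi; exact/subsetPset/ndF/leq_maxl.
  by move: Gj; exact/subsetPset/ndG/leq_maxr.
have [mF Fk] := Foo k; have [mG Gk] := Goo k.
split.
  rewrite -[X in measurable X]setTI.
  by apply: measurable_rV_uncons => //; exact: measurableX.
rewrite /lebesgue_cons /pushforward -comp_preimage.
rewrite (_ : _ \o _ = id); last by apply/funext => p /=; rewrite rV_consK.
by rewrite preimage_id product_measure1E// lte_mul_pinfty// ge0_fin_numE.
Qed.

HB.instance Definition _ := Measure_isSigmaFinite.Build _ _ _ lebesgue_cons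
  lebesgue_cons_sigma_finite.

End cons.

(* Lebesgue measure on R^n: the n-fold product of the Lebesgue measure on R,
   transported to row vectors by (x, v) |-> rV_cons (x, v); on the one-point
   space 'rV[R]_0 it is the unit mass. *)
Fixpoint lebesgue_rV (n : nat) :
    {sigma_finite_measure set 'rV[R]_n -> \bar R} :=
  match n with
  | 0 => \d_(0 : 'rV[R]_0)
  | m.+1 => lebesgue_cons (lebesgue_rV m)
  end.

Lemma lebesgue_rV_prod (n : nat) (A : 'I_n -> set R) :
  (forall i, measurable (A i)) ->
  lebesgue_rV n [set v | forall i, A i (v ord0 i)] =
  (\prod_(i < n) lebesgue_measure (A i))%E.
Proof.
elim: n A => [|n IHn] A mA.
  rewrite big_ord0/= diracE mem_set//= => i.
  by case: i.
rewrite big_ord_recl -IHn// -product_measure1E//.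
  rewrite /= /lebesgue_cons /pushforward; congr (product_measure1 _ _ _).
  apply/seteqP; split => [p /= pA|p /= [p1 p2] i].
    by split=> [|i]; [rewrite -rV_cons0|rewrite -rV_consS]; exact: pA.
  by have [j ->|->] := unliftP ord0 i; rewrite ?rV_consS ?rV_cons0.
  exact: mA.
set S := (X in measurable X).
have -> : S = \bigcap_(i in [set: 'I_n]) (rV_coord i @^-1` A (lift ord0 i)).
  by apply/seteqP; split => [v /= vA i _|v /= vA i]; exact: vA.
apply: fin_bigcap_measurable => // i _.
rewrite -[X in measurable X]setTI.
exact: (measurable_rV_coord i).
Qed.

End lebesgue_rV.

Section functions_on_rV.
Context (R : realType) (n : nat).
Implicit Types (f : 'rV[R]_n -> R).

(* The library norm on 'rV[R]_n is the sup norm. *)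
Definition euclid_norm (v : 'rV[R]_n) : R :=
  Num.sqrt (\sum_(i < n) v ord0 i ^+ 2).

Definition CL f : Prop :=
  [/\ continuous f, bounded_fun f &
      (lebesgue_rV R n).-integrable setT (EFin \o f)].

End functions_on_rV.

Definition Gamma (R : realType) (z : R) : R :=
  \int[lebesgue_measure]_(t in `]0, +oo[) (t `^ (z - 1) * expR (- t)).

Section gaussian_processes.
Context (R : realType) (disp : measure_display) (T : measurableType disp).
Variable P : probability T R.

(* A Gaussian law may be degenerate; the library's normal_prob m 0 is not
   the Dirac mass, hence the case distinction. *)
Definition gaussian (Y : T -> R) : Prop :=
  measurable_fun setT Y /\
  exists m s : R, forall A : set R, measurable A ->
    P (Y @^-1` A) = if s == 0 then \d_m A else normal_prob m s A.

Implicit Types X : R -> T -> R.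

(* Processes are indexed by R but only times t >= 0 matter. *)
Definition gaussian_process X : Prop :=
  forall (k : nat) (t a : 'I_k -> R), (forall j, 0 <= t j) ->
    gaussian (fun w => \sum_(j < k) a j * X (t j) w).

Definition fractional_brownian_motion1 (H : R) X : Prop :=
  [/\ gaussian_process X,
      forall t : R, 0 <= t -> 'E_P[X t]%E = 0%E,
      forall t s : R, 0 <= t -> 0 <= s ->
        'E_P[X t \* X s]%E =
        (2^-1 * (t `^ (2 * H) + s `^ (2 * H) - `|t - s| `^ (2 * H)))%:E &
      forall w, {within `[0, +oo[, continuous (fun t => X t w)}].

Definition process_sigma_algebra X : set (set T) :=
  <<s \bigcup_(t in [set t | 0 <= t])
        preimage_set_system setT (X t) measurable >>.

(* Taking some A i equal to the whole space gives the product rule for the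
   subfamilies. *)
Definition independent_processes (n : nat) (X : 'I_n -> R -> T -> R) : Prop :=
  forall A : 'I_n -> set T, (forall i, process_sigma_algebra (X i) (A i)) ->
    P (\bigcap_i A i) = (\prod_(i < n) P (A i))%E.

Definition fractional_brownian_motion (H : R) (n : nat)
    (B : R -> T -> 'rV[R]_n) : Prop :=
  let coord (i : 'I_n) t w := B t w ord0 i in
  (forall i, fractional_brownian_motion1 H (coord i)) /\
  independent_processes coord.

(* Where the integral is infinite the real-valued integral below defaults
   to 0, so its existence has to be asserted separately. *)
Definition perpetual_integral (n : nat) (f : 'rV[R]_n -> R) (x : 'rV[R]_n)
    (B : R -> T -> 'rV[R]_n) (w : T) : R :=
  \int[lebesgue_measure]_(t in `[0, +oo[) f (x + B t w).

End gaussian_processes.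

Definition C_const (R : realType) (d : nat) (H : R) : R :=
  2 `^ (- (1 + (2 * H)^-1)) * H^-1 * pi `^ (- (d%:R / 2)) *
  Gamma (d%:R / 2 - (2 * H)^-1).

(* Main.v *)
(* By Tonelli the mean is the integral over t of E f(x + B_t); the law of B_t has
   the density (2 pi)^(-d/2) t^(-dH) exp (- |y|^2 / (2 t^(2H))), whose
   time integral is a Gamma integral after u = |y|^2 t^(-2H) / 2. Finiteness
   follows from E f(x + B_t) <= min (sup f, C t^(-dH)), as dH > 1.

   For non-constancy let Z be the first coordinate of B at time 1, and weigh P by
   exp (lam Z - lam^2 / 2). Since rho(t) = E[Z B_t^1] > 0 for t > 0, the weighted
   law of B_t is its original law shifted by lam rho(t) along the first axis. If the
   perpetual integral were a constant c, then c would be its mean under every one of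
   these weighted laws, that is the time integral of the mean of f over the
   shifted laws. Each of these means tends to 0 as lam grows, and they share the
   above integrable bound, so c = 0; but the mean is positive when f <> 0.

   That the pair (B_t^1, Z) has the expected Gaussian law is a Cramer-Wold statement:
   two finite measures on the plane with the same linear images agree on
   trigonometric polynomials, and indicators of quadrants are bounded limits of
   such polynomials, obtained by iterating y |-> (3 y - y^3) / 2 on sines. *)
Require Import Defs.
From HB Require Import structures.
From mathcomp Require Import all_boot all_order all_algebra.
From mathcomp Require Import all_classical all_reals all_analysis.
From mathcomp Require Import measurable_realfun.
From mathcomp Require Import ring lra.

Set Implicit Arguments.
Unset Strict Implicit.
Unset Printing Implicit Defensive.

Import Order.TTheory GRing.Theory Num.Theory.
Import numFieldNormedType.Exports.

Local Open Scope classical_set_scope.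
Local Open Scope ring_scope.

(** * Densities and Gaussian measures on the line *)

(** The definition of a Gaussian process only gives the laws of single linear combinations, whereas
    weighing by a function of Z involves the joint law of Z and B_t^1; this gap is the reason for
    the Cramer-Wold argument. The remaining coordinates keep their laws under the weight by
    independence. The function rho is the Cameron-Martin direction attached to Z, and time 1 is a
    convenient choice since rho is then positive at every t > 0, so that the shift lam rho(t)
    escapes to infinity at each such time. Taking lam = 0 recovers the original law, so a single
    formula for the weighted laws serves both the mean and the non-constancy.

    All of this is carried out with the extended-real time integral, to which Tonelli applies before
    any finiteness is known; almost sure finiteness is then read off from the finite mean. The joint
    measurability that Tonelli asks for comes from the continuity of the paths. *)

Section density.
Context d (T : measurableType d) (R : realType).
Variables (mu : {measure set T -> \bar R}) (g : T -> R).
Hypotheses (mg : measurable_fun setT g) (g0 : forall x, 0 <= g x).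
Local Open Scope ereal_scope.

Import HBNNSimple.

Let density A := \int[mu]_(x in A) (g x)%:E.

Let density0 : density set0 = 0.
Proof. exact: integral_set0. Qed.

Let density_ge0 A : 0 <= density A.
Proof. by apply: integral_ge0 => x _; rewrite lee_fin. Qed.

Let density_sigma_additive : semi_sigma_additive density.
Proof.
move=> F mF tF mUF; rewrite /density ge0_integral_bigcup//; last 2 first.
- exact/measurable_EFinP/measurable_funTS.
- by move=> x _; rewrite lee_fin.
by apply: is_cvg_ereal_nneg_natsum_cond => n _ _; exact: density_ge0.
Qed.

HB.instance Definition _ := isMeasure.Build _ _ _ density
  density0 density_ge0 density_sigma_additive.

Lemma density_measure : exists nu : {measure set T -> \bar R},
  forall A, nu A = \int[mu]_(x in A) (g x)%:E.
Proof. by exists density. Qed.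

Lemma integral_density_nnsfun (nu : {measure set T -> \bar R})
    (h : {nnsfun T >-> R}) :
  (forall A, measurable A -> nu A = \int[mu]_(x in A) (g x)%:E) ->
  \int[nu]_x (h x)%:E = \int[mu]_x ((h x)%:E * (g x)%:E).
Proof.
move=> nuE; rewrite integralT_nnsfun sintegralE.
under [RHS]eq_integral => x _.
  rewrite fimfunE -fsumEFin// ge0_mule_fsuml; last first.
    by move=> k; rewrite nnfun_muleindic_ge0.
  over.
rewrite ge0_integral_fsum//; last 2 first.
- move=> k; apply: emeasurable_funM; apply/measurable_EFinP => //.
  exact: measurable_funM.
- move=> k x _; apply: mule_ge0; rewrite ?lee_fin//.
  exact: nnfun_muleindic_ge0.
apply: eq_fsbigr => k _; have [k0|k0] := ltP k 0%R.
  rewrite preimage_nnfun0// measure0 mule0 integral0_eq// => x _.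
  by rewrite indicE in_set0 mulr0 mul0e.
under eq_integral do rewrite EFinM -muleA.
rewrite ge0_integralZl//; last 2 first.
- by apply: emeasurable_funM; exact/measurable_EFinP.
- by move=> x _; rewrite mule_ge0 ?lee_fin.
congr (_ * _); rewrite nuE// integral_mkcond; apply: eq_integral => x _.
by rewrite patchE indicE; case: ifPn => _; rewrite ?mul1e ?mul0e.
Qed.

(** Only the values of [nu] on measurable sets are prescribed, so the formula serves [normal_prob],
    the restriction of [P] to an event and the weighted probability alike. It passes from simple
    functions to [h] by monotone convergence. *)
Lemma ge0_integral_density (nu : {measure set T -> \bar R}) (h : T -> \bar R) :
  (forall A, measurable A -> nu A = \int[mu]_(x in A) (g x)%:E) ->
  measurable_fun setT h -> (forall x, 0 <= h x) ->
  \int[nu]_x h x = \int[mu]_x (h x * (g x)%:E).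
Proof.
move=> nuE mh h0; pose h_ := nnsfun_approx measurableT mh.
transitivity (limn (fun n => \int[nu]_x (h_ n x)%:E)).
  rewrite -monotone_convergence//=.
  - apply: eq_integral => x _; apply/esym/cvg_lim => //=.
    by apply: cvg_nnsfun_approx.
  - by move=> n; exact/measurable_EFinP/measurable_funTS.
  - by move=> n ? _; rewrite lee_fin.
  - by move=> ? _ ? ? mn; rewrite lee_fin; exact/lefP/nd_nnsfun_approx.
rewrite (_ : (fun n => _) = (fun n => \int[mu]_x ((h_ n x)%:E * (g x)%:E))); last first.
  by apply/funext => n; exact: integral_density_nnsfun.
rewrite -monotone_convergence//=.
- apply: eq_integral => x _; apply/cvg_lim => //.
  apply: cvgeMr => //; last exact: cvg_nnsfun_approx.
- by move=> n; apply: emeasurable_funM; exact/measurable_EFinP.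
- by move=> n ? _; rewrite mule_ge0 ?lee_fin.
- move=> x _ a b ab; rewrite lee_wpmul2r ?lee_fin//.
  exact/lefP/nd_nnsfun_approx.
Qed.

End density.

Section affine.
Context (R : realType).
Local Notation mu := (@lebesgue_measure R).

Lemma measurable_affine (a b : R) : measurable_fun setT (fun u : R => a * u + b).
Proof. by apply: measurable_funD => //; exact: measurable_funM. Qed.

Let affine_measure (a b : R) : {measure set (measurableTypeR R) -> \bar R} :=
  [the measure _ _ of mscale (NngNum (normr_ge0 a))
   [the measure _ _ of (measure_function_pushforward__canonical__measure_function_Measure
     mu (@measurable_affine a b : @measurable_fun _ _ (measurableTypeR R) (measurableTypeR R) _ _))]].

(** The image measure scaled by [|a|] gives each interval []x, y]] its length, and this
    characterizes Lebesgue measure. *)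
Lemma lebesgue_affine (a b : R) (A : set R) : a != 0 -> measurable A ->
  mu A = (`|a|%:E * mu ((fun u => a * u + b)%R @^-1` A))%E.
Proof.
move=> a0 mA; rewrite (@lebesgue_measure_unique _ (affine_measure a b))//.
move=> _ [[x y] _ <-] /=.
rewrite /affine_measure/= /mscale/= /pushforward lebesgue_measure_itv/=.
have [a_gt0|a_lt0|/esym/eqP] := ltgtP 0 a; last by rewrite (negbTE a0).
  rewrite (_ : _ @^-1` _ = `](x - b) / a, (y - b) / a]%classic); last first.
    apply/seteqP; split => u /=; rewrite !in_itv/=;
    by rewrite ltr_pdivrMr// ler_pdivlMr// ltrBlDr lerBrDr mulrC.
  rewrite lebesgue_measure_itv/= !lte_fin ltr_pM2r ?invr_gt0// ltrD2r.
  rewrite gtr0_norm//; case: ifP => _; last by rewrite mule0.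
  by rewrite -!EFinB -EFinM; congr EFin; field.
(* A negative slope reverses the interval, so the open end of the preimage is now on the right. *)
rewrite (_ : _ @^-1` _ = `[(y - b) / a, (x - b) / a[%classic); last first.
  apply/seteqP; split => u /=; rewrite !in_itv/=;
  by rewrite ltr_ndivlMr// ler_ndivrMr// ltrBlDr lerBrDr mulrC andbC.
rewrite lebesgue_measure_itv/= !lte_fin ltr_nM2r ?invr_lt0// ltrD2r.
rewrite ltr0_norm//; case: ifP => _; last by rewrite mule0.
by rewrite -!EFinB -EFinM; congr EFin; field.
Qed.

Lemma ge0_integral_affine (a b : R) (h : R -> \bar R) : a != 0 ->
  measurable_fun setT h -> (forall x, 0 <= h x)%E ->
  (\int[mu]_x h x = `|a|%:E * \int[mu]_x h (a * x + b)%R)%E.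
Proof.
move=> a0 mh h0.
rewrite (eq_measure_integral (affine_measure a b)); last first.
  by move=> A mA _; exact: lebesgue_affine.
rewrite /affine_measure ge0_integral_mscale//=.
rewrite ge0_integral_pushforward//=; last exact: measurable_affine.
Qed.

End affine.

Section normal.
Context (R : realType).
Local Notation mu := (@lebesgue_measure R).

Lemma integral_normal_prob (m s : R) (h : R -> \bar R) :
  measurable_fun setT h -> (forall x, 0 <= h x)%E ->
  (\int[normal_prob m s]_x h x = \int[mu]_x (h x * (normal_pdf m s x)%:E))%E.
Proof.
move=> mh h0; apply: ge0_integral_density => //.
- exact: measurable_normal_pdf.
- by move=> x; exact: normal_pdf_ge0.
Qed.

Lemma normal_pdf_affine (m s u : R) : s != 0 ->
  `|s| * normal_pdf m s (s * u + m) = normal_pdf 0 1 u.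
Proof.
move=> s0; rewrite !normal_pdfE ?oner_neq0//= /normal_peak /normal_fun.
rewrite mulrA; congr (_ * expR _); last first.
  by rewrite addrK subr0; field.
rewrite expr1n mul1r -mulrnAr sqrtrM ?sqr_ge0// sqrtr_sqr invfM mulrA divff ?mul1r//.
by rewrite normr_eq0.
Qed.

Lemma normal_prob_affine (m s : R) (A : set R) : s != 0 -> measurable A ->
  normal_prob m s A = normal_prob 0 1 ((fun u => s * u + m) @^-1` A).
Proof.
move=> s0 mA; rewrite /normal_prob.
have mpdf : measurable_fun setT ((fun x => (normal_pdf m s x)%:E) \_ A).
  apply/(measurable_restrictT (fun x => (normal_pdf m s x)%:E)) => //.
  apply/measurable_funTS/measurable_EFinP; exact: measurable_normal_pdf.
rewrite integral_mkcond (@ge0_integral_affine _ s m)//; last first.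
- by move=> x; apply: erestrict_ge0 => y _; rewrite lee_fin normal_pdf_ge0.
rewrite -ge0_integralZl//; last 2 first.
- by apply: (measurableT_comp mpdf); exact: measurable_affine.
- by move=> x _; apply: erestrict_ge0 => y _; rewrite lee_fin normal_pdf_ge0.
rewrite [RHS]integral_mkcond; apply: eq_integral => x _.
rewrite !patchE (_ : (x \in _ @^-1` A) = (s * x + m \in A)); last first.
  by apply/idP/idP; rewrite !inE.
by case: ifPn => _; rewrite ?mule0// -EFinM normal_pdf_affine.
Qed.

End normal.

Section normal_moments.
Context (R : realType).
Local Notation mu := (@lebesgue_measure R).
Local Notation phi := (@normal_pdf R 0 1).

(** The antiderivative that opens [x * (x * phi x)] to integration by parts. *)
Lemma is_derive_normal_pdf (x : R) : is_derive x 1 (- phi) (x * phi x).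
Proof.
rewrite !normal_pdfE ?oner_neq0//= /normal_peak /normal_fun.
set c := (Num.sqrt _)^-1.
have -> : - (fun x0 : R => c * expR (- (x0 - 0) ^+ 2 / (1 ^+ 2 *+ 2))) =
    (- c) \*: (expR \o (fun y => (- 2^-1) * (y * y))).
  apply/funext => y; rewrite -[RHS]/(- c * expR (- 2^-1 * (y * y))) mulNr.
  by congr (- (c * expR _)); rewrite subr0 expr1n; field.
apply: is_derive_eq.
rewrite /= subr0 expr1n.
have -> : - x ^+ 2 / (1 *+ 2) = - 2^-1 * (x * x) by field.
by rewrite /GRing.scale/=; field.
Qed.

Lemma continuous_phi : continuous phi.
Proof. exact/continuous_normal_pdf/oner_neq0. Qed.

(** From [1 + u <= expR u] at [u = n^2 / 2]. It controls the boundary terms of the integration by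
    parts on [[-(n+1), n+1]]. *)
Lemma normal_pdf_bound (n : nat) : n%:R ^+ 2 * phi n%:R <= 2 * phi 0.
Proof.
rewrite !normal_pdfE ?oner_neq0//=.
rewrite mulrCA [leRHS]mulrCA ler_wpM2l ?normal_peak_ge0// /normal_fun.
rewrite !subr0 expr0n/= oppr0 mul0r expR0 mulr1 expr1n.
rewrite (_ : - _ / _ = - (n%:R ^+ 2 / 2)) ?mulNr// expRN.
rewrite ler_pdivrMr ?expR_gt0//.
have := expR_ge1Dx (n%:R ^+ 2 / 2 : R).
move=> h; apply: le_trans (_ : 2 * (1 + n%:R ^+ 2 / 2) <= _).
  by lra.
by rewrite ler_pM2l.
Qed.

Lemma normal_second_moment_itv (n : nat) :
  (\int[mu]_(x in `[(- n.+1%:R)%R, n.+1%:R]) (x ^+ 2 * phi x)%:E =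
   (- 2 * n.+1%:R * phi n.+1%:R)%:E +
   \int[mu]_(x in `[(- n.+1%:R)%R, n.+1%:R]) (phi x)%:E)%E.
Proof.
have phiN x : phi (- x) = phi x.
  by rewrite !normal_pdfE ?oner_neq0//= /normal_fun !subr0 sqrrN.
under eq_integral do rewrite expr2 -mulrA.
have dn : - n.+1%:R < n.+1%:R :> R.
  by rewrite (@lt_trans _ _ 0) ?oppr_lt0 ?ltr0Sn.
have derivable_is (F f : R -> R) (a b : R) : (forall x : R, is_derive x 1 F (f x)) ->
    derivable_oo_LRcontinuous F a b /\ {in `]a, b[, F^`()%classic =1 f}.
  move=> dF; have cF : continuous F.
    by move=> x; apply/differentiable_continuous/derivable1_diffP; case: (dF x).
  split; last by move=> x _; rewrite derive1E; apply: derive_val.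
  split; first by move=> x _; case: (dF x).
  - by apply: cvg_at_right_filter; exact: cF.
  - by apply: cvg_at_left_filter; exact: cF.
have [d1 d1E] := derivable_is id (cst 1) (- n.+1%:R) n.+1%:R (fun x => is_derive_id x 1).
have [d2 d2E] := derivable_is _ _ (- n.+1%:R) n.+1%:R is_derive_normal_pdf.
rewrite (@integration_by_parts _ id (fun x => - phi x) (cst 1) (fun x => x * phi x))//.
- congr (_ + _)%E; first by congr EFin; rewrite /= phiN; ring.
  rewrite (_ : \int[mu]_(x in _) _ = - \int[mu]_(x in `[(- n.+1%:R)%R, n.+1%:R]) (phi x)%:E)%E ?oppeK//.
  rewrite -integral_ge0N; last by move=> x _; rewrite lee_fin normal_pdf_ge0.
  by apply: eq_integral => x _; rewrite mul1r EFinN.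
- by apply: continuous_subspaceT => x; exact: cvg_cst.
- by apply: continuous_subspaceT => x; apply: cvgM; [exact: cvg_id|exact: continuous_phi].
Qed.

Lemma normal_second_moment : (\int[mu]_x (x ^+ 2 * phi x)%:E = 1)%E.
Proof.
pose F n : set R := `[(- n.+1%:R)%R, n.+1%:R]%classic.
have ndF : nondecreasing_seq F.
  move=> m n mn; apply/subsetPset; apply: subset_itv; rewrite leBSide/=.
    by rewrite lerN2 ler_nat.
  by rewrite ler_nat.
have bF : \bigcup_n F n = setT.
  apply/seteqP; split => // x _; exists (Num.truncn `|x|) => //=.
  by rewrite /F/= in_itv/= -ler_norml ltW// truncnS_gt.
have phi0 (x : R) : (0 <= (phi x)%:E)%E by rewrite lee_fin normal_pdf_ge0.
have mphi : measurable_fun setT (EFin \o phi).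
  by apply/measurable_EFinP; exact: measurable_normal_pdf.
have mF n : measurable (F n) by exact: measurable_itv.
have := @ge0_nondecreasing_set_cvg_integral _ (measurableTypeR R) _ F (EFin \o phi) mu ndF mF
  (fun n => measurable_funTS mphi) (fun n x _ => phi0 x).
rewrite bF/= integral_normal_pdf => c1.
have x20 (x : R) : (0 <= (x ^+ 2 * phi x)%:E)%E.
  by rewrite lee_fin mulr_ge0 ?sqr_ge0 ?normal_pdf_ge0.
have mx2 : measurable_fun setT (fun x : R => (x ^+ 2 * phi x)%:E).
  by apply/measurable_EFinP; apply: measurable_funM => //; exact: measurable_normal_pdf.
have := @ge0_nondecreasing_set_cvg_integral _ (measurableTypeR R) _ F _ mu ndF mF
  (fun n => measurable_funTS mx2) (fun n x _ => x20 x).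
rewrite bF => c2; apply: (cvg_unique _ c2) => //.
have -> : (fun n => \int[mu]_(x in F n) (x ^+ 2 * phi x)%:E)%E =
    (fun n => (- 2 * n.+1%:R * phi n.+1%:R)%:E + \int[mu]_(x in F n) (phi x)%:E)%E.
  by apply/funext => n; exact: normal_second_moment_itv.
(* The intervals exhaust the line, so the integral of [phi] tends to 1 and only the boundary term is
   left. *)
suff c0 : (- 2 * n.+1%:R * phi n.+1%:R)%:E @[n --> \oo] --> (0 : R)%:E.
  by rewrite -[1%E]add0e; apply: cvgeD.
apply: cvg_EFin; first exact: nearW.
have hb (n : nat) : 0 <= 2 * n.+1%:R * phi n.+1%:R <= 4 * phi 0 * harmonic n.
  have := normal_pdf_bound n.+1; rewrite /harmonic /= => h.
  rewrite ler_pdivlMr ?ltr0Sn// !mulr_ge0 ?normal_pdf_ge0//=.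
  by have := normal_pdf_ge0 0 1 (0 : R); nra.
apply: (@squeeze_cvgr _ _ _ _ (fun n => - (4 * phi 0) * harmonic n) (fun=> 0)).
- apply: nearW => n /=; have /andP[h1 h2] := hb n.
  by rewrite !mulNr lerN2 h2/= oppr_le0.
- have : - (4 * phi 0) * @harmonic R n @[n --> \oo] --> - (4 * phi 0) * 0.
    by apply: cvgM; [exact: cvg_cst|exact: cvg_harmonic].
  by rewrite mulr0.
- exact: cvg_cst.
Qed.

End normal_moments.

(** * Rotation invariance of the standard normal law *)

Section normal_rotation.
Context (R : realType).
Local Notation mu := (@lebesgue_measure R).
Local Notation N := (@normal_prob R 0 1).

Lemma normal_pdf_sqr (s s' x : R) : s ^+ 2 = s' ^+ 2 ->
  normal_pdf 0 s x = normal_pdf 0 s' x.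
Proof.
move=> ss'; rewrite /normal_pdf /normal_peak /normal_fun ss'.
by rewrite -[s == 0]sqrf_eq0 ss' sqrf_eq0.
Qed.

(** Scales are recovered from variances only up to sign. The zero scale, which has no density, is
    treated apart. *)
Lemma normal_scale_sqr (s s' : R) (A : set R) : s ^+ 2 = s' ^+ 2 ->
  measurable A -> N ((fun u => s * u) @^-1` A) = N ((fun u => s' * u) @^-1` A).
Proof.
move=> ss' mA; have [s0|s0] := eqVneq s 0.
  suff -> : s' = s by []; rewrite s0; apply/eqP.
  by rewrite -sqrf_eq0 -ss' s0 expr0n.
have s'0 : s' != 0 by rewrite -sqrf_eq0 -ss' sqrf_eq0.
have E r : (fun u : R => r * u) = (fun u => r * u + 0).
  by apply/funext => u; rewrite addr0.
rewrite !E -(normal_prob_affine 0 s0 mA) -(normal_prob_affine 0 s'0 mA); apply: eq_integral => x _.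
by rewrite (normal_pdf_sqr x ss').
Qed.

(* Completing the square. *)
Lemma normal_pdf_convolution (a b v x : R) : a != 0 ->
  let r := Num.sqrt (a ^+ 2 + b ^+ 2) in
  normal_pdf 0 1 v * normal_pdf (b * v) a x =
  normal_pdf 0 r x * normal_pdf (b * x / r ^+ 2) (a / r) v.
Proof.
move=> a0 r; have r2 : r ^+ 2 = a ^+ 2 + b ^+ 2.
  by rewrite sqr_sqrtr// addr_ge0// sqr_ge0.
have r2_gt0 : 0 < a ^+ 2 + b ^+ 2 by rewrite ltr_pwDl ?sqr_ge0// exprn_even_gt0.
have r0 : r != 0 by rewrite gt_eqF// sqrtr_gt0.
rewrite !normal_pdfE ?oner_neq0// ?mulf_neq0 ?invr_eq0//.
rewrite mulrACA [RHS]mulrACA /normal_peak /normal_fun -!expRD.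
congr (_ * expR _); last first.
  rewrite !expr_div_n !r2 expr1n; field; rewrite a0/=.
  by rewrite (gt_eqF r2_gt0).
have sp (s : R) : (Num.sqrt (s ^+ 2 * pi *+ 2))^-1 = `|s|^-1 * (Num.sqrt (pi *+ 2))^-1.
  by rewrite -mulrnAr sqrtrM ?sqr_ge0// sqrtr_sqr invfM.
rewrite !sp normr1 normrM normfV; field.
by rewrite !normr_eq0 a0 r0 gt_eqF// sqrtr_gt0 pmulrn_rgt0// pi_gt0.
Qed.

Lemma measurable_normal_pdf2 (a b : R) : a != 0 -> measurable_fun setT
  (fun p : R * R => normal_pdf (b * p.1) a p.2).
Proof.
move=> a0; rewrite (_ : (fun _ => _) =
    (fun p : R * R => normal_pdf 0 a (p.2 - b * p.1))); last first.
  by apply/funext => p; rewrite !normal_pdfE// /normal_fun subr0.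
apply: (measurableT_comp (measurable_normal_pdf 0 a)).
by apply: measurable_funB => //; exact: measurable_funM.
Qed.

(** By [normal_pdf_convolution] the joint density of [v = p.1] and [x = b v + a p.2] is the density
    of [x] times a conditional density of [v]. After Tonelli the latter integrates to 1. *)
Lemma normal_prob_rotation_neq0 (a b : R) (A : set R) : a != 0 -> measurable A ->
  (N \x N)%E [set p | A (b * p.1 + a * p.2)] =
  N ((fun u => Num.sqrt (a ^+ 2 + b ^+ 2) * u) @^-1` A).
Proof.
move=> a0 mA; set r := Num.sqrt _.
have r_gt0 : 0 < r by rewrite sqrtr_gt0 ltr_pwDl ?sqr_ge0// exprn_even_gt0.
rewrite (_ : (fun u => r * u) = (fun u => r * u + 0)); last first.
  by apply/funext => u; rewrite addr0.
rewrite -normal_prob_affine ?gt_eqF//.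
have NE v : N (xsection [set p | A (b * p.1 + a * p.2)] v) = normal_prob (b * v) a A.
  rewrite [RHS]normal_prob_affine//; apply: (f_equal N); apply/seteqP; split => u /=;
  by rewrite /xsection/= inE/= addrC.
rewrite [LHS]/product_measure1/=.
under eq_integral do rewrite /= NE.
have mnn : measurable_fun setT (fun v => normal_prob (b * v) a A).
  have := @measurable_fun_xsection _ _ _ _ _ N [set p | A (b * p.1 + a * p.2)].
  rewrite (_ : _ \o _ = (fun v => normal_prob (b * v) a A)); last exact/funext.
  apply; rewrite -[X in measurable X]setTI.
  have : measurable_fun setT (fun p : R * R => b * p.1 + a * p.2).
    by apply: measurable_funD; exact: measurable_funM.
  exact.
rewrite integral_normal_prob//.
pose h (p : R * R) := (normal_pdf 0 1 p.1 * normal_pdf (b * p.1) a p.2 * \1_A p.2)%:E.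
have h0 p : (0 <= h p)%E.
  by rewrite lee_fin !mulr_ge0// normal_pdf_ge0.
have mh : measurable_fun setT h.
  apply/measurable_EFinP; apply: measurable_funM.
    apply: measurable_funM; last exact: measurable_normal_pdf2.
    by apply: (measurableT_comp (measurable_normal_pdf 0 1)).
  by apply: (@measurableT_comp _ _ _ _ _ _ (\1_A : R -> R)).
transitivity (\int[mu]_v \int[mu]_x h (v, x))%E.
  apply: eq_integral => v _; rewrite /normal_prob integral_mkcond muleC.
  rewrite -ge0_integralZl//.
  - apply: eq_integral => x _; rewrite /h/= patchE indicE.
    by case: ifPn => _; rewrite ?mulr1 ?mulr0 ?mule0// EFinM.
  - apply/(measurable_restrictT (fun x => (normal_pdf (b * v) a x)%:E)) => //.
    by apply/measurable_funTS/measurable_EFinP; exact: measurable_normal_pdf.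
  - by move=> x _; apply: erestrict_ge0 => y _; rewrite lee_fin normal_pdf_ge0.
  - by rewrite lee_fin normal_pdf_ge0.
rewrite (@fubini_tonelli _ _ _ _ _ mu mu h mh h0) [RHS]integral_mkcond.
apply: eq_integral => x _; rewrite /fubini_G patchE /h/=.
under eq_integral do rewrite normal_pdf_convolution//.
rewrite indicE; case: ifPn => _; last first.
  by rewrite integral0_eq// => v _; rewrite mulr0.
under eq_integral do rewrite mulr1 EFinM.
rewrite ge0_integralZl//; last 3 first.
- by apply/measurable_EFinP; exact: measurable_normal_pdf.
- by move=> v _; rewrite lee_fin normal_pdf_ge0.
- by rewrite lee_fin normal_pdf_ge0.
by rewrite integral_normal_pdf mule1.
Qed.

Lemma normal_prob_rotation (a b : R) (A : set R) : measurable A ->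
  (N \x N)%E [set p | A (b * p.1 + a * p.2)] =
  N ((fun u => Num.sqrt (a ^+ 2 + b ^+ 2) * u) @^-1` A).
Proof.
have [->|a0] := eqVneq a 0; last exact: normal_prob_rotation_neq0.
(* For [a = 0] the event is a strip over the first coordinate. *)
move=> mA; rewrite (_ : [set _ | _] = ((fun u => b * u) @^-1` A) `*` setT); last first.
  by apply/seteqP; split => [p /=|p /= []]; rewrite mul0r addr0.
rewrite product_measure1E//; last first.
  by rewrite -[X in measurable X]setTI; exact: (measurable_funM).
rewrite [X in (_ * X)%E](@probability_setT _ _ _ N) mule1.
by apply: normal_scale_sqr => //; rewrite expr0n add0r sqr_sqrtr// sqr_ge0.
Qed.

End normal_rotation.

(** * The Cramer-Wold theorem in the plane *)

Section sign_approximation.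
Context (R : realType).

(* The iterates converge on [-1, 1] to the sign function; since the map is a
   polynomial, they preserve trigonometric polynomials. *)
Definition sign_step (y : R) : R := 3 / 2 * y - 2^-1 * (y * y * y).

Lemma sign_stepN y : sign_step (- y) = - sign_step y.
Proof. rewrite /sign_step; ring. Qed.

Lemma iter_sign_stepN k y : iter k sign_step (- y) = - iter k sign_step y.
Proof. by elim: k => //= k ->; rewrite sign_stepN. Qed.

(** [1 - sign_step z] is [1 - z] times [(1 - z)(2 + z)/2 = 1 - z/2 - z^2/2], and the latter is at
    most [1 - y/2] as long as [z >= y]. The distance to 1 thus shrinks geometrically. *)
Lemma iter_sign_step_gt0 k y : 0 < y <= 1 ->
  y <= iter k sign_step y <= 1 /\ 1 - iter k sign_step y <= (1 - y / 2) ^+ k.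
Proof.
move=> /andP[y0 y1]; elim: k => [|k [/andP[h1 h2] h3]] /=.
  by rewrite lexx y1 expr0; split => //; lra.
set z := iter _ _ _ in h1 h2 h3 *.
have z0 : 0 < z by apply: lt_le_trans h1.
have E : 1 - sign_step z = (1 - z) * ((1 - z) * (2 + z) / 2).
  by rewrite /sign_step; field.
have E2 : sign_step z - z = z * ((1 - z) * (1 + z)) / 2.
  by rewrite /sign_step; field.
have sz : z <= sign_step z.
  rewrite -subr_ge0 E2 divr_ge0// mulr_ge0 ?(ltW z0)// mulr_ge0 ?subr_ge0//.
  by lra.
split; last first.
  rewrite E exprSr ler_pM ?subr_ge0// ?divr_ge0// ?mulr_ge0 ?subr_ge0//.
    by lra.
  rewrite ler_pdivrMr//; nra.
apply/andP; split; first exact: le_trans sz.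
rewrite -subr_ge0 E mulr_ge0 ?subr_ge0// divr_ge0// mulr_ge0 ?subr_ge0//; lra.
Qed.

(* The limits -1, 0, 1 of the iterates are sent to 0, 0, 1. *)
Definition pos_approx k y : R :=
  2^-1 * (iter k sign_step y * iter k sign_step y + iter k sign_step y).

Lemma pos_approx_le1 k y : `|y| <= 1 -> `|pos_approx k y| <= 1.
Proof.
move=> y1; have [y0|y0|y0] := ltgtP 0 y; last 1 first.
- have -> : pos_approx k y = 0; last by rewrite normr0.
  rewrite -y0 /pos_approx; have -> : iter k sign_step 0 = 0.
    by elim: k => //= k ->; rewrite /sign_step; ring.
  by ring.
- have [|/andP[h1 h2] _] := @iter_sign_step_gt0 k y.
    by rewrite y0 (le_trans (ler_norm _) y1).
  by rewrite /pos_approx ler_norml; apply/andP; split; nra.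
- have [|/andP[h1 h2] _] := @iter_sign_step_gt0 k (- y).
    by rewrite oppr_gt0 y0 (le_trans _ y1)// -normrN ler_norm.
  move: h1 h2; rewrite iter_sign_stepN => h1 h2.
  by rewrite /pos_approx ler_norml; apply/andP; split; nra.
Qed.

Lemma cvg_pos_approx y : `|y| <= 1 ->
  pos_approx k y @[k --> \oo] --> ((0 < y)%R%:R : R).
Proof.
move=> y1.
have pos (z : R) : 0 < z <= 1 -> iter k sign_step z @[k --> \oo] --> (1 : R).
  move=> /andP[z0 z1].
  apply: (@squeeze_cvgr _ _ _ _ (fun k => 1 - (1 - z / 2) ^+ k) (fun=> 1)).
  - apply: nearW => k; have [|/andP[h1 h2] h3] := @iter_sign_step_gt0 k z.
      by rewrite z0.
    by rewrite h2 andbT; lra.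
  - have : 1 - (1 - z / 2) ^+ k @[k --> \oo] --> (1 - 0 : R).
      apply: cvgB; first exact: cvg_cst.
      apply: cvg_expr; rewrite ger0_norm; lra.
    by rewrite subr0.
  - exact: cvg_cst.
have lim (l : R) : iter k sign_step y @[k --> \oo] --> l ->
    pos_approx k y @[k --> \oo] --> 2^-1 * (l * l + l).
  by move=> h; apply: cvgM; [exact: cvg_cst|apply: cvgD => //; exact: cvgM].
have [y0|y0|y0] := ltgtP 0 y.
- have := lim 1 (pos y _); rewrite y0 (le_trans (ler_norm _) y1) => /(_ isT).
  by rewrite (_ : 2^-1 * _ = 1%:R); last by field.
- have hN : - iter k sign_step (- y) @[k --> \oo] --> (- 1 : R).
    apply: (@cvgN _ R^o); apply: pos.
    by rewrite oppr_gt0 y0 (le_trans _ y1)// -normrN ler_norm.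
  have := lim (- 1); rewrite (_ : 2^-1 * _ = 0%:R); last by ring.
  apply; under eq_fun do rewrite -[iter _ _ y]opprK -iter_sign_stepN.
  exact: hN.
- rewrite -y0 (_ : pos_approx^~ 0 = fun=> 0); first exact: cvg_cst.
  apply/funext => k; rewrite /pos_approx; have -> : iter k sign_step 0 = 0.
    by elim: k => //= k ->; rewrite /sign_step; ring.
  by ring.
Qed.

(** Sine has the sign of its argument on []-1, 1[], since [1 <= pi]; hence the sequence is
    eventually constant. Stretching the period is what removes the periodicity of the approximating
    functions. *)
Lemma cvg_sin_gt0 (x : R) :
  ((0 < sin (x / n.+1%:R))%R%:R : R) @[n --> \oo] --> ((0 < x)%R%:R : R).
Proof.
apply: cvg_near_cst.
have [N hN] : exists N : nat, `|x| < N%:R.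
  by exists (Num.truncn `|x|).+1; exact: truncnS_gt.
exists N => // n /= Nn.
have n0 : (0 : R) < n.+1%:R by rewrite ltr0Sn.
have xn : `|x| / n.+1%:R < 1.
  by rewrite ltr_pdivrMr// mul1r (lt_le_trans hN)// ler_nat (leq_trans Nn).
have pi1 : 1 <= (pi : R) by apply: le_trans (pi_ge2 R); lra.
have [x0|x0|<-] := ltgtP 0 x; last by rewrite mul0r sin0 ltxx.
- rewrite sin_gt0_pi// divr_gt0//= (lt_le_trans _ pi1)//.
  by move: xn; rewrite gtr0_norm.
- apply/eqP; rewrite ltNge -oppr_ge0 -sinN -mulNr ltW// sin_gt0_pi//.
  rewrite divr_gt0 ?oppr_gt0//= (lt_le_trans _ pi1)//.
  by move: xn; rewrite ltr0_norm.
Qed.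

End sign_approximation.

Section trigonometric_polynomials.
Context (R : realType).

(** The phase [e] lets cosines alone cover sines and constants, and the addition formulas turn
    products of cosines into sums. *)
Inductive trig_poly : (R * R -> R) -> Prop :=
| trig_cos c a b e : trig_poly (fun p => c * cos (a * p.1 + b * p.2 + e))
| trig_add f g : trig_poly f -> trig_poly g -> trig_poly (fun p => f p + g p).

Lemma trig_scale k f : trig_poly f -> trig_poly (fun p => k * f p).
Proof.
elim=> [c a b e|{}f g _ kf _ kg].
  rewrite (_ : (fun _ => _) = fun p => k * c * cos (a * p.1 + b * p.2 + e)).
    exact: trig_cos.
  by apply/funext => p; rewrite mulrA.
rewrite (_ : (fun _ => _) = fun p => k * f p + k * g p); first exact: trig_add.
by apply/funext => p; rewrite mulrDr.
Qed.

Lemma trig_mul f g : trig_poly f -> trig_poly g -> trig_poly (fun p => f p * g p).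
Proof.
move=> tf tg; elim: tf => [c a b e|{}f h _ IHf _ IHh]; last first.
  rewrite (_ : (fun _ => _) = fun p => f p * g p + h p * g p); first exact: trig_add.
  by apply/funext => p; rewrite mulrDl.
elim: tg => [c' a' b' e'|{}f h _ IHf _ IHh]; last first.
  rewrite (_ : (fun _ => _) = fun p => c * cos (a * p.1 + b * p.2 + e) * f p +
     c * cos (a * p.1 + b * p.2 + e) * h p); first exact: trig_add.
  by apply/funext => p; rewrite mulrDr.
rewrite (_ : (fun _ => _) = fun p =>
    (c * c' / 2) * cos ((a + a') * p.1 + (b + b') * p.2 + (e + e')) +
    (c * c' / 2) * cos ((a - a') * p.1 + (b - b') * p.2 + (e - e'))).
  by apply: trig_add; exact: trig_cos.
apply/funext => p; set x := a * p.1 + b * p.2 + e; set y := a' * p.1 + b' * p.2 + e'.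
rewrite (_ : (a + a') * _ + _ + _ = x + y); last by rewrite /x /y; ring.
rewrite (_ : (a - a') * _ + _ + _ = x - y); last by rewrite /x /y; ring.
by clearbody x y; rewrite cosD cosB; field.
Qed.

Lemma trig_iter_sign_step f k : trig_poly f ->
  trig_poly (fun p => iter k (@sign_step R) (f p)).
Proof.
move=> tf; elim: k => //= k IH.
rewrite (_ : (fun _ => _) = fun p => 3 / 2 * iter k (@sign_step R) (f p) + - 2^-1 *
  (iter k (@sign_step R) (f p) * iter k (@sign_step R) (f p) * iter k (@sign_step R) (f p))).
  apply: trig_add; apply: trig_scale => //.
  by apply: trig_mul => //; exact: trig_mul.
by apply/funext => p; rewrite mulNr.
Qed.

Lemma trig_pos_approx f k : trig_poly f -> trig_poly (fun p => pos_approx k (f p)).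
Proof.
move=> tf; apply: trig_scale; apply: trig_add; last exact: trig_iter_sign_step.
by apply: trig_mul; exact: trig_iter_sign_step.
Qed.

End trigonometric_polynomials.

Section cramer_wold_rays.
Context (R : realType) (mu nu : {measure set (R * R) -> \bar R}).
Hypotheses (mufin : (mu setT < +oo)%E) (nufin : (nu setT < +oo)%E).
Hypothesis munu : forall (a b : R) (A : set R), measurable A ->
  mu [set p | A (a * p.1 + b * p.2)] = nu [set p | A (a * p.1 + b * p.2)].

(** The test functions that do not distinguish [mu] from [nu]. Measurability and boundedness are
    part of it so that it is stable under uniformly bounded pointwise limits. *)
Let agree (g : R * R -> R) := [/\ measurable_fun setT g,
  exists M, forall p, `|g p| <= M &
  (\int[mu]_p (g p)%:E = \int[nu]_p (g p)%:E)%E].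

Let cst_integrable (m : {measure set (R * R) -> \bar R}) (M : R) :
  (m setT < +oo)%E -> m.-integrable setT (cst M%:E).
Proof.
move=> mfin; apply/integrableP; split; first exact: measurable_cst.
rewrite (eq_integral (cst `|M|%:E))// integral_cst// lte_mul_pinfty// ?lee_fin//.
Qed.

Let bounded_integrable (m : {measure set (R * R) -> \bar R}) (g : R * R -> R) M :
  (m setT < +oo)%E -> measurable_fun setT g -> (forall p, `|g p| <= M) ->
  m.-integrable setT (EFin \o g).
Proof.
move=> mfin mg gM; apply: (@le_integrable _ _ _ _ _ measurableT _ (cst M%:E)).
- exact/measurable_EFinP.
- move=> p _; rewrite /= lee_fin; apply: le_trans (gM p) _; exact: ler_norm.
- exact: cst_integrable.
Qed.

Let agree_lim (g_ : nat -> R * R -> R) g M :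
  (forall n, agree (g_ n)) -> (forall n p, `|g_ n p| <= M) ->
  (forall p, g_ n p @[n --> \oo] --> g p) -> agree g.
Proof.
move=> ag gM gl.
have mg : measurable_fun setT g.
  by apply: (measurable_fun_cvg (h := g_)) => [n|p _]; [case: (ag n)|exact: gl].
have lim (m : {measure set (R * R) -> \bar R}) : (m setT < +oo)%E ->
    (\int[m]_p (g_ n p)%:E)%E @[n --> \oo] --> (\int[m]_p (g p)%:E)%E.
  move=> mfin.
  have [] // := @dominated_convergence _ _ _ m _ measurableT
    (fun n p => (g_ n p)%:E) (fun p => (g p)%:E) (cst M%:E).
  - by move=> n; apply/measurable_EFinP; case: (ag n).
  - exact/measurable_EFinP.
  - by apply: aeW => p _; apply: cvg_EFin; [exact: nearW|exact: gl].
  - exact: cst_integrable.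
  - by apply: aeW => p n _; rewrite lee_fin.
split => //.
  exists M => p; have h : `|g_ n p| @[n --> \oo] --> `|g p|.
    by apply: (@cvg_norm _ R^o); exact: gl.
  have <- := cvg_lim _ h => //.
  apply: limr_le; first by apply/cvg_ex; exists `|g p|.
  by apply: nearW => n; exact: gM.
have := lim mu mufin.
have E : (fun n => \int[mu]_p (g_ n p)%:E)%E = (fun n => \int[nu]_p (g_ n p)%:E)%E.
  by apply/funext => n; have [] := ag n.
rewrite E.
by move=> /cvg_lim <-//; apply/cvg_lim => //; exact: lim.
Qed.

Let measurable_linear (a b : R) : measurable_fun setT (fun p : R * R => a * p.1 + b * p.2).
Proof. by apply: measurable_funD; exact: measurable_funM. Qed.

(** A cosine of [a p.1 + b p.2 + e] is integrated against the image of the measure under this linear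
    form, and [munu] says that the two images coincide. *)
Let agree_trig f : trig_poly f -> agree f.
Proof.
elim=> [c a b e|{}f g _ [mf [M fM] If] _ [mg [M' gM] Ig]]; last first.
  split; first exact: measurable_funD.
    by exists (M + M') => p; rewrite (le_trans (ler_normD _ _))// lerD.
  under eq_integral do rewrite EFinD.
  under [RHS]eq_integral do rewrite EFinD.
  by rewrite !integralD ?If ?Ig//; apply: bounded_integrable; eassumption.
pose h (x : R) := c * cos (x + e).
have mh : measurable_fun setT h.
  apply: measurable_funM => //.
  apply: (@measurableT_comp _ _ _ _ _ _ (@cos R)); last exact: measurable_funD.
  by apply: continuous_measurable_fun; exact: continuous_cos.
have hM x : `|h x| <= `|c| by rewrite normrM ler_piMr// cos_max.
have mhl := measurableT_comp mh (measurable_linear a b).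
split => //; first by exists `|c| => p; exact: hM.
pose law (m : {measure set (R * R) -> \bar R}) : {measure set R -> \bar R} :=
  measure_function_pushforward__canonical__measure_function_Measure
    m (measurable_linear a b).
have E (m : {measure set (R * R) -> \bar R}) : (m setT < +oo)%E ->
    (\int[m]_p (c * cos (a * p.1 + b * p.2 + e))%:E = \int[law m]_x (h x)%:E)%E.
  move=> mfin; rewrite [RHS]integral_pushforward//.
  - exact/measurable_EFinP.
  - rewrite preimage_setT.
    by apply: (@bounded_integrable m (h \o (fun p => a * p.1 + b * p.2)) `|c|) => // p; exact: hM.
rewrite !E//; apply: eq_measure_integral => A mA _; exact: munu.
Qed.

Lemma cramer_wold_ray (x y : R) :
  mu (`]x, +oo[ `*` `]y, +oo[) = nu (`]x, +oo[ `*` `]y, +oo[).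
Proof.
pose s (n : nat) (a u : R) := sin ((u - a) / n.+1%:R).
have s1 n a u : `|s n a u| <= 1 by rewrite /s -cosBpihalf cos_max.
(* For a fixed period, letting [k] grow turns trigonometric polynomials into the indicator that two
   sines are positive. *)
have agree1 n : agree (fun p => (0 < s n x p.1)%R%:R * (0 < s n y p.2)%R%:R).
  apply: (@agree_lim (fun k p => pos_approx k (s n x p.1) * pos_approx k (s n y p.2)) _ 1).
  - move=> k; apply: agree_trig; apply: trig_mul; apply: trig_pos_approx.
      rewrite (_ : (fun _ => _) = fun p => 1 * cos (n.+1%:R^-1 * p.1 + 0 * p.2 +
        (- x / n.+1%:R - pi / 2))); first exact: trig_cos.
      by apply/funext => p; rewrite /s -cosBpihalf mul1r; congr cos; ring.
    rewrite (_ : (fun _ => _) = fun p => 1 * cos (0 * p.1 + n.+1%:R^-1 * p.2 +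
      (- y / n.+1%:R - pi / 2))); first exact: trig_cos.
    by apply/funext => p; rewrite /s -cosBpihalf mul1r; congr cos; ring.
  - by move=> k p; rewrite normrM mulr_ile1 ?pos_approx_le1.
  - by move=> p; apply: cvgM; exact: cvg_pos_approx.
(* Letting the period grow turns that indicator into the one of the quadrant. *)
have : agree (fun p => (0 < p.1 - x)%R%:R * (0 < p.2 - y)%R%:R).
  apply: (@agree_lim (fun n p => (0 < s n x p.1)%R%:R * (0 < s n y p.2)%R%:R) _ 1) => //.
  - by move=> k p; rewrite normrM mulr_ile1// ger0_norm ?ler0n// lern1 leq_b1.
  - by move=> p; apply: cvgM; exact: cvg_sin_gt0.
have -> : (fun p : R * R => (0 < p.1 - x)%R%:R * (0 < p.2 - y)%R%:R : R) =
    \1_(`]x, +oo[ `*` `]y, +oo[).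
  apply/funext => p; rewrite indicE -natrM mulnb; congr (nat_of_bool _)%:R.
  rewrite !subr_gt0; apply/andP/idP; rewrite inE/= !in_itv/= !andbT => //.
by case=> _ _; rewrite !integral_indic ?setIT//; exact: measurableX.
Qed.

End cramer_wold_rays.

Section cramer_wold_measures.
Context (R : realType).

Lemma measure_eq_ray (m1 m2 : {measure set R -> \bar R}) :
  (m1 setT < +oo)%E -> (forall x, m1 `]x, +oo[%classic = m2 `]x, +oo[%classic) ->
  forall A, measurable A -> m1 A = m2 A.
Proof.
move=> m1fin m12 A mA; apply: (@measure_unique _ R R (@RGenOInfty.G R) (fun n => `](- n%:R), +oo[%classic)).
- exact: RGenOInfty.measurableE.
- move=> _ _ [x ->] [y ->]; exists (Num.max x y); apply/seteqP; split => z /=;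
  by rewrite !in_itv/= !andbT gt_max => /andP.
- by move=> n; exists (- n%:R).
- apply/seteqP; split => // x _; exists (Num.truncn `|x|).+1 => //=.
  rewrite in_itv/= andbT ltrNl (le_lt_trans (ler_norm _))// normrN.
  exact: truncnS_gt.
- by move=> _ [x ->]; exact: m12.
- by move=> n; apply: le_lt_trans m1fin; apply: le_measure; rewrite ?inE.
- exact: mA.
Qed.

(** Quadrants are widened to rectangles one side at a time: with one factor frozen, restricting to a
    strip and projecting gives a measure on the line, which its rays determine. Rectangles then
    determine the measure on the plane. *)
Lemma cramer_wold (mu nu : {measure set (R * R) -> \bar R}) :
  (mu setT < +oo)%E -> (nu setT < +oo)%E ->
  (forall (a b : R) (A : set R), measurable A ->
    mu [set p | A (a * p.1 + b * p.2)] = nu [set p | A (a * p.1 + b * p.2)]) ->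
  forall S, measurable S -> mu S = nu S.
Proof.
move=> mufin nufin munu.
have fin (m : {measure set (R * R) -> \bar R}) X : (m setT < +oo)%E ->
    measurable X -> (m X < +oo)%E.
  by move=> mfin mX; apply: le_lt_trans mfin; apply: le_measure; rewrite ?inE.
have step1 (y : R) (A : set R) : measurable A ->
    mu (A `*` `]y, +oo[) = nu (A `*` `]y, +oo[).
  have mY : measurable ([set: R] `*` `]y, +oo[%classic) by exact: measurableX.
  pose law (m : {measure set (R * R) -> \bar R}) : {measure set R -> \bar R} :=
    measure_function_pushforward__canonical__measure_function_Measure
      (mrestr m mY) (measurable_fst).
  have lawE m B : law m B = m (B `*` `]y, +oo[).
    rewrite /law/= /pushforward /mrestr; congr (m _).
    by apply/seteqP; split => p /= => [[? []]|[]].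
  rewrite -!lawE; apply: measure_eq_ray.
    by rewrite lawE fin//; exact: measurableX.
  by move=> x; rewrite !lawE; exact: cramer_wold_ray.
have step2 (A B : set R) : measurable A -> measurable B ->
    mu (A `*` B) = nu (A `*` B).
  move=> mA.
  have mX : measurable (A `*` [set: R]) by exact: measurableX.
  pose law (m : {measure set (R * R) -> \bar R}) : {measure set R -> \bar R} :=
    measure_function_pushforward__canonical__measure_function_Measure
      (mrestr m mX) (measurable_snd).
  have lawE m C : law m C = m (A `*` C).
    rewrite /law/= /pushforward /mrestr; congr (m _).
    by apply/seteqP; split => p /= => [[? []]|[]].
  rewrite -!lawE; apply: measure_eq_ray.
    by rewrite lawE fin//; exact: measurableX.
  by move=> y; rewrite !lawE; exact: step1.
move=> S mS; apply: (measure_unique [set A `*` B | A in measurable & B in measurable]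
   (fun=> setT)) => //.
- exact: measurable_prod_measurableType.
- move=> _ _ [A mA [B mB <-]] [A' mA' [B' mB' <-]]; rewrite -setXI.
  by exists (A `&` A'); [exact: measurableI|exists (B `&` B') => //; exact: measurableI].
- by move=> _; exists setT => //; exists setT => //; rewrite setXTT.
- by apply/seteqP; split => // p _; exists 0.
- by move=> _ [A mA [B mB <-]]; exact: step2.
Qed.

End cramer_wold_measures.

Section gaussian_law.
Context (R : realType).
Local Notation mu := (@lebesgue_measure R).
Local Notation N := (@normal_prob R 0 1).

Lemma integrable_normal_sqr : N.-integrable setT (fun u : R => (u ^+ 2)%:E).
Proof.
apply/integrableP; split.
  by apply/measurable_EFinP; exact: measurable_funX.
under eq_integral do rewrite /= ger0_norm ?sqr_ge0//.
rewrite integral_normal_prob//; last 2 first.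
- by apply/measurable_EFinP; exact: measurable_funX.
- by move=> x; rewrite lee_fin sqr_ge0.
under eq_integral do rewrite -EFinM.
by rewrite normal_second_moment ltry.
Qed.

Lemma integrable_normal_cst (c : R) : N.-integrable setT (cst c%:E).
Proof. exact: finite_measure_integrable_cst. Qed.

Lemma integrable_normal_id : N.-integrable setT (fun u : R => u%:E).
Proof.
apply: (@le_integrable _ (measurableTypeR R) R N setT measurableT _ (fun u : R => (u ^+ 2)%:E + cst 1%:E u)%E).
- exact/measurable_EFinP.
- move=> u _; rewrite /= lee_fin [leRHS]ger0_norm ?addr_ge0 ?sqr_ge0//.
  rewrite -(real_normK (num_real u)).
  by have := normr_ge0 u; have := sqr_ge0 (`|u| - 1); nra.
- by apply: integrableD => //; [exact: integrable_normal_sqr|exact: integrable_normal_cst].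
Qed.

(** The standard normal law is invariant under [u |-> - u], so its mean equals its own opposite;
    integrability makes this mean a real number. *)
Lemma integral_normal_id : (\int[N]_u u%:E = 0)%E.
Proof.
have mN : @measurable_fun _ _ (measurableTypeR R) (measurableTypeR R) setT (fun u : R => -1 * u).
  by apply: measurable_funM.
pose law : {measure set (measurableTypeR R) -> \bar R} :=
  measure_function_pushforward__canonical__measure_function_Measure N mN.
have : (\int[N]_u u%:E = \int[law]_u u%:E)%E.
  apply: eq_measure_integral => A mA _; rewrite /law/= /pushforward.
  rewrite -(@normal_scale_sqr _ 1 (-1))//; last by rewrite sqrrN.
  by apply: (f_equal N); apply/seteqP; split => u /=; rewrite mul1r.
rewrite integral_pushforward//; last first.
  rewrite preimage_setT (_ : _ \o _ = (fun u : R => (-1)%:E * u%:E)%E).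
    by apply: integrableZl => //; exact: integrable_normal_id.
  by apply/funext.
rewrite preimage_setT (_ : _ \o _ = (fun u : R => (-1)%:E * u%:E)%E)//.
rewrite integralZl//; last exact: integrable_normal_id.
have : (\int[N]_u u%:E)%E \is a fin_num.
  by apply: integrable_fin_num => //; exact: integrable_normal_id.
move=> /fineK <-; rewrite -EFinM => -[] h; congr EFin; lra.
Qed.

Lemma integral_normal_sqr : (\int[N]_u (u ^+ 2)%:E = 1)%E.
Proof.
rewrite integral_normal_prob//; last 2 first.
- by apply/measurable_EFinP; exact: measurable_funX.
- by move=> x; rewrite lee_fin sqr_ge0.
under eq_integral do rewrite -EFinM.
exact: normal_second_moment.
Qed.

End gaussian_law.

(** * Gaussian laws of fractional Brownian motion *)

Section gaussian_centered.
Context (R : realType) (disp : measure_display) (T : measurableType disp).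
Variable P : probability T R.
Local Notation N := (@normal_prob R 0 1).

(* The image of the standard normal law under an affine map covers the
   degenerate Gaussian laws as well. *)
Lemma gaussian_affine_law (Y : T -> R) : gaussian P Y -> exists m s : R,
  forall A, measurable A -> P (Y @^-1` A) = N ((fun u => s * u + m) @^-1` A).
Proof.
move=> [mY [m [s YE]]]; exists m, s => A mA; rewrite YE//.
have [->|s0] := eqVneq s 0; last exact: normal_prob_affine.
rewrite diracE; have [Am|Am] := boolP (m \in A).
  rewrite (_ : _ @^-1` _ = setT) ?[RHS](@probability_setT _ _ _ N)//.
  by apply/seteqP; split => // u _ /=; rewrite mul0r add0r -inE.
rewrite (_ : _ @^-1` _ = set0) ?measure0//.
apply/seteqP; split => // u /=; rewrite mul0r add0r => mA'.
by move: Am; rewrite mem_set.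
Qed.

Lemma integral_normal_cst (c : R) : (\int[N]_u cst c%:E u = c%:E)%E.
Proof.
rewrite integral_cst// -[RHS]mule1; congr (_ * _)%E.
exact: (@probability_setT _ _ _ N).
Qed.

Lemma integrable_of_sqr (Y : T -> R) : measurable_fun setT Y ->
  (\int[P]_w (Y w ^+ 2)%:E < +oo)%E -> P.-integrable setT (fun w => (Y w)%:E).
Proof.
move=> mY Y2.
apply: (@le_integrable _ _ _ _ _ measurableT _ (fun w => (Y w ^+ 2)%:E + cst 1%:E w)%E).
- exact/measurable_EFinP.
- move=> w _; rewrite /= lee_fin [leRHS]ger0_norm ?addr_ge0 ?sqr_ge0//.
  rewrite -(real_normK (num_real (Y w))).
  by have := normr_ge0 (Y w); have := sqr_ge0 (`|Y w| - 1); nra.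
- apply: integrableD => //; last exact: finite_measure_integrable_cst.
  apply/integrableP; split; first by apply/measurable_EFinP; exact: measurable_funX.
  by under eq_integral do rewrite /= ger0_norm ?sqr_ge0//.
Qed.

(** The two moments force [m = 0] and [s^2 = q] on the unknown parameters of the law, and by
    [normal_scale_sqr] the sign of [s] is immaterial. *)
Lemma gaussian_centered_law (Y : T -> R) (q : R) : gaussian P Y ->
  (\int[P]_w (Y w)%:E = 0)%E -> (\int[P]_w (Y w ^+ 2)%:E = q%:E)%E ->
  0 <= q /\
  forall A, measurable A -> P (Y @^-1` A) = N ((fun u => Num.sqrt q * u) @^-1` A).
Proof.
move=> gY EY EY2; have [mY _] := gY.
have [m [s YE]] := gaussian_affine_law gY.
have mY' : @measurable_fun _ _ T (measurableTypeR R) setT Y by [].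
have mA' : @measurable_fun _ _ (measurableTypeR R) (measurableTypeR R) setT
   (fun u : R => s * u + m) by exact: measurable_affine.
pose lawY : {measure set (measurableTypeR R) -> \bar R} :=
  measure_function_pushforward__canonical__measure_function_Measure P mY'.
pose lawN : {measure set (measurableTypeR R) -> \bar R} :=
  measure_function_pushforward__canonical__measure_function_Measure N mA'.
have lawE h : (\int[lawY]_x h x = \int[lawN]_x h x)%E.
  by apply: eq_measure_integral => A mA _; exact: YE.
have iN := @integrable_normal_id R.
have iN2 := @integrable_normal_sqr R.
have q_eq : q = s ^+ 2 + m ^+ 2.
  apply: EFin_inj; rewrite -EY2.
  transitivity (\int[lawY]_x (x ^+ 2)%:E)%E.
    rewrite ge0_integral_pushforward//.
    - by apply/measurable_EFinP; exact: measurable_funX.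
    - by move=> x _; rewrite lee_fin sqr_ge0.
  rewrite lawE ge0_integral_pushforward//; last 2 first.
  - by apply/measurable_EFinP; exact: measurable_funX.
  - by move=> x _; rewrite lee_fin sqr_ge0.
  rewrite preimage_setT; transitivity (\int[N]_u ((s ^+ 2)%:E * (u ^+ 2)%:E +
      ((2 * s * m)%:E * u%:E + cst (m ^+ 2)%:E u)))%E.
    by apply: eq_integral => u _; rewrite /= -!EFinM -!EFinD; congr EFin; ring.
  rewrite integralD//; last 2 first.
  - exact: integrableZl.
  - by apply: integrableD => //; [exact: integrableZl|exact: integrable_normal_cst].
  rewrite integralD//; last 2 first.
  - exact: integrableZl.
  - exact: integrable_normal_cst.
  rewrite !integralZl// integral_normal_sqr integral_normal_id integral_normal_cst.
  by rewrite mule0 add0e mule1.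
have m0 : m = 0.
  apply: EFin_inj; rewrite -[RHS]/(0%E) -EY.
  transitivity (\int[lawY]_x x%:E)%E.
    rewrite lawE integral_pushforward//; last first.
      rewrite preimage_setT (_ : _ \o _ = (fun u => s%:E * u%:E + cst m%:E u)%E).
        by apply: integrableD => //; [exact: integrableZl|exact: integrable_normal_cst].
      by apply/funext.
    rewrite preimage_setT (_ : _ \o _ = (fun u => s%:E * u%:E + cst m%:E u)%E)//.
    rewrite integralD//; last 2 first.
    - exact: integrableZl.
    - exact: integrable_normal_cst.
    by rewrite integralZl// integral_normal_id mule0 add0e integral_normal_cst.
  rewrite [LHS]integral_pushforward// preimage_setT.
  by apply: integrable_of_sqr => //; rewrite EY2 ltry.
have q0 : 0 <= q by rewrite q_eq m0 addr_ge0 ?sqr_ge0.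
split=> // A mA; rewrite YE// m0.
rewrite (_ : (fun u => s * u + 0) = (fun u => s * u)); last first.
  by apply/funext => u; rewrite addr0.
apply: normal_scale_sqr => //.
by rewrite sqr_sqrtr// q_eq m0 expr0n addr0.
Qed.

Variables (H : R) (X : R -> T -> R).
Hypotheses (H0 : 0 < H) (fX : fractional_brownian_motion1 P H X).

Definition fbm_cov (H t s : R) : R :=
  2^-1 * (t `^ (2 * H) + s `^ (2 * H) - `|t - s| `^ (2 * H)).

Lemma fbm_covtt (t : R) : fbm_cov H t t = t `^ (2 * H).
Proof.
rewrite /fbm_cov subrr normr0 powR0 ?mulf_neq0 ?gt_eqF//.
by rewrite subr0; field.
Qed.

Lemma measurable_fbm (t : R) : 0 <= t -> measurable_fun setT (X t).
Proof.
move=> t0; have [gX _ _ _] := fX.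
have [+ _] := gX 1%N (fun=> t) (fun=> 1) (fun=> t0).
by rewrite (_ : (fun _ => _) = X t)//; apply/funext => w; rewrite big_ord1 mul1r.
Qed.

Let integrable_fbm_sqr (t : R) : 0 <= t ->
  P.-integrable setT (fun w => (X t w ^+ 2)%:E).
Proof.
move=> t0; have [_ _ cX _] := fX.
apply/integrableP; split.
  by apply/measurable_EFinP; apply: measurable_funX; exact: measurable_fbm.
under eq_integral do rewrite /= ger0_norm ?sqr_ge0//.
by have := cX t t t0 t0; rewrite unlock /= => ->; rewrite ltry.
Qed.

Let integrable_fbm (t : R) : 0 <= t -> P.-integrable setT (fun w => (X t w)%:E).
Proof.
move=> t0; apply: integrable_of_sqr; first exact: measurable_fbm.
have /integrableP[_] := integrable_fbm_sqr t0.
by under eq_integral do rewrite /= ger0_norm ?sqr_ge0//.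
Qed.

Let integrable_fbm_mul (t s : R) : 0 <= t -> 0 <= s ->
  P.-integrable setT (fun w => (X t w * X s w)%:E).
Proof.
move=> t0 s0.
apply: (@le_integrable _ _ _ _ _ measurableT _
  (fun w => (X t w ^+ 2)%:E + (X s w ^+ 2)%:E)%E).
- apply/measurable_EFinP; apply: measurable_funM; exact: measurable_fbm.
- move=> w _; rewrite /= lee_fin [leRHS]ger0_norm ?addr_ge0 ?sqr_ge0//.
  rewrite normrM -(real_normK (num_real (X t w))) -(real_normK (num_real (X s w))).
  have := normr_ge0 (X t w); have := normr_ge0 (X s w).
  by have := sqr_ge0 (`|X t w| - `|X s w|); nra.
- by apply: integrableD => //; exact: integrable_fbm_sqr.
Qed.

(** [Q] is the variance of the combination. Its sign stands in for the Cauchy-Schwarz inequality: it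
    makes the residual variance in [fbm_pair_law] nonnegative. *)
Lemma fbm_linear_law (t s a b : R) : 0 <= t -> 0 <= s ->
  let Q := a ^+ 2 * t `^ (2 * H) + 2 * a * b * fbm_cov H t s + b ^+ 2 * s `^ (2 * H) in
  0 <= Q /\ forall A, measurable A ->
  P [set w | A (a * X t w + b * X s w)] = N ((fun u => Num.sqrt Q * u) @^-1` A).
Proof.
move=> t0 s0 Q; have [gX EX cX _] := fX.
apply: gaussian_centered_law.
- have := gX 2%N (fun j => if j == ord0 then t else s) (fun j => if j == ord0 then a else b).
  rewrite (_ : (fun _ => _) = (fun w => a * X t w + b * X s w)).
    by apply => j; case: ifP.
  by apply/funext => w; rewrite big_ord_recl big_ord1.
- under eq_integral do rewrite EFinD !EFinM.
  rewrite integralD//; last 2 first.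
  - by apply: integrableZl => //; exact: integrable_fbm.
  - by apply: integrableZl => //; exact: integrable_fbm.
  rewrite !integralZl//; last 2 first.
  - exact: integrable_fbm.
  - exact: integrable_fbm.
  have := EX _ t0; have := EX _ s0; rewrite unlock => -> ->.
  by rewrite !mule0 adde0.
- transitivity (\int[P]_w ((a ^+ 2)%:E * (X t w ^+ 2)%:E +
    ((2 * a * b)%:E * (X t w * X s w)%:E + (b ^+ 2)%:E * (X s w ^+ 2)%:E)))%E.
    by apply: eq_integral => w _; rewrite -!EFinM -!EFinD; congr EFin; ring.
  have it := integrable_fbm_sqr t0. have is_ := integrable_fbm_sqr s0.
  have its := integrable_fbm_mul t0 s0.
  rewrite integralD//; last 2 first.
  - exact: integrableZl.
  - by apply: integrableD => //; exact: integrableZl.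
  rewrite integralD//; last 2 first.
  - exact: integrableZl.
  - exact: integrableZl.
  rewrite !integralZl//.
  have := cX _ _ t0 t0; have := cX _ _ s0 s0; have := cX _ _ t0 s0.
  rewrite unlock /= => -> -> ->; rewrite -/(fbm_cov H _ _) -!EFinM -!EFinD.
  by congr EFin; rewrite -!/(fbm_cov H _ _) !fbm_covtt /Q; ring.
Qed.

End gaussian_centered.

(** * Exponential change of measure for one coordinate *)

Section fbm_tilt.
Context (R : realType) (disp : measure_display) (T : measurableType disp).
Variables (P : probability T R) (H : R) (X : R -> T -> R).
Hypotheses (H0 : 0 < H) (fX : fractional_brownian_motion1 P H X).
Local Notation mu := (@lebesgue_measure R).
Local Notation N := (@normal_prob R 0 1).
Local Notation rho t := (fbm_cov H t 1).

Lemma powR_double (t : R) : 0 <= t -> t `^ (2 * H) = (t `^ H) ^+ 2.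
Proof.
by move=> t0; rewrite mulrC powRrM -powR_mulrn ?powR_ge0.
Qed.

(** The regression of [X t] on [X 1]: [q.1] plays the part of [X 1], which has variance 1, and
    [p * q.2] that of the independent residual. *)
Let gauss_pair (r p : R) : R * R -> R * R := fun q => (r * q.1 + p * q.2, q.1).

Let measurable_gauss_pair (r p : R) : measurable_fun setT (gauss_pair r p).
Proof.
apply/measurable_fun_pairP; split; last exact: measurable_fst.
by apply: measurable_funD; exact: measurable_funM.
Qed.

(** Both laws have the same linear images, one by [fbm_linear_law], the other by rotation
    invariance, and Cramer-Wold concludes. *)
Lemma fbm_pair_law (t : R) : 0 <= t -> exists p : R,
  p ^+ 2 + rho t ^+ 2 = t `^ (2 * H) /\
  forall S : set (R * R), measurable S ->
    P [set w | S (X t w, X 1 w)] = (N \x N)%E (gauss_pair (rho t) p @^-1` S).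
Proof.
move=> t0.
have q0 : 0 <= t `^ (2 * H) - rho t ^+ 2.
  (* The number in question is the variance of [X t - rho t * X 1]. *)
  have [+ _] := fbm_linear_law H0 fX 1 (- rho t) t0 ler01.
  by rewrite powR1; congr (_ <= _); ring.
exists (Num.sqrt (t `^ (2 * H) - rho t ^+ 2)); split.
  by rewrite sqr_sqrtr// subrK.
set p := Num.sqrt _; move=> S mS.
have mXX : measurable_fun setT (fun w => (X t w, X 1 w)).
  by apply/measurable_fun_pairP; split => /=; apply: measurable_fbm fX _ _.
pose lawX : {measure set (R * R) -> \bar R} :=
  measure_function_pushforward__canonical__measure_function_Measure P mXX.
pose lawN : {measure set (R * R) -> \bar R} :=
  measure_function_pushforward__canonical__measure_function_Measure
    (N \x N)%E (measurable_gauss_pair (rho t) p).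
apply: (@cramer_wold _ lawX lawN) => //.
- by rewrite /lawX/= /pushforward preimage_setT probability_setT ltry.
- rewrite /lawN/= /pushforward preimage_setT -setXTT product_measure1E//.
  rewrite (_ : (_ * _)%E = (1 * 1)%E); first by rewrite mule1 ltry.
  by congr (_ * _)%E; exact: (@probability_setT _ _ _ N).
- move=> a b A mA; rewrite /lawX/lawN/= /pushforward.
  have [_ ->] // := fbm_linear_law H0 fX a b t0 ler01.
  rewrite powR1 (_ : _ @^-1` _ =
    [set q | A ((a * rho t + b) * q.1 + (a * p) * q.2)]); last first.
    by apply/funext => q; rewrite /preimage /mkset /=; congr (A _); ring.
  rewrite normal_prob_rotation// (_ : _ + b ^+ 2 * 1 = (a * p) ^+ 2 + (a * rho t + b) ^+ 2)//.
  by rewrite exprMn sqr_sqrtr//; ring.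
Qed.

Let tilt_density (lam : R) (v : R) : R := expR (lam * v - lam ^+ 2 / 2).

Lemma measurable_tilt_density lam : measurable_fun setT (tilt_density lam).
Proof.
by apply: measurableT_comp => //; apply: measurable_funB.
Qed.

(** [expR (lam v - lam^2 / 2)] times the standard normal density at [v] is that density at
    [v - lam]. *)
Lemma normal_tilt (lam : R) (h : R -> \bar R) : measurable_fun setT h ->
  (forall x, 0 <= h x)%E ->
  (\int[N]_v ((tilt_density lam v)%:E * h v) = \int[N]_v h (v + lam)%R)%E.
Proof.
move=> mh h0.
rewrite !integral_normal_prob//; last 3 first.
- apply: (measurableT_comp mh); exact: measurable_funD.
- apply: emeasurable_funM => //; apply/measurable_EFinP.
  exact: measurable_tilt_density.
- by move=> v; rewrite mule_ge0// lee_fin expR_ge0.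
rewrite (@ge0_integral_affine _ 1 lam)//; last 2 first.
- apply: emeasurable_funM; last first.
    by apply/measurable_EFinP; exact: measurable_normal_pdf.
  apply: emeasurable_funM => //; apply/measurable_EFinP.
  exact: measurable_tilt_density.
- by move=> v; rewrite !mule_ge0// lee_fin ?expR_ge0 ?normal_pdf_ge0.
rewrite normr1 mul1e; apply: eq_integral => v _.
rewrite mul1r muleAC muleC; congr (_ * _)%E.
rewrite -EFinM; congr EFin.
rewrite !normal_pdfE ?oner_neq0//= mulrCA; congr (_ * _).
rewrite /normal_fun /tilt_density -expRD; congr expR.
by rewrite !subr0 expr1n; field.
Qed.

(** The law of the pair is exhibited as a measure on the plane because [fbm_tilt_cylinder] rescales
    it by the probability of an event of the other coordinates before integrating. *)
Lemma fbm_tilt_law (t lam : R) (A : set R) : 0 < t -> measurable A ->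
  exists2 law : {measure set (R * R) -> \bar R},
  (forall S, measurable S -> P [set w | S (X t w, X 1 w)] = law S) &
  (\int[law]_z ((tilt_density lam z.2)%:E * (\1_A z.1)%:E) =
   normal_prob (lam * rho t) (t `^ H) A)%E.
Proof.
move=> t0 mA; have [p [pE lawE]] := fbm_pair_law (ltW t0).
pose law : {measure set (R * R) -> \bar R} :=
  measure_function_pushforward__canonical__measure_function_Measure
    (N \x N)%E (measurable_gauss_pair (rho t) p).
exists law => //.
have m1 : measurable_fun setT (fun x : R => (\1_A x : R)%:E).
  by apply/measurable_EFinP; exact: measurable_indic.
have mg : measurable_fun setT (fun z : R * R => ((tilt_density lam z.2)%:E * (\1_A z.1)%:E)%E).
  apply: emeasurable_funM.
    by apply/measurable_EFinP; apply: (measurableT_comp (measurable_tilt_density lam)).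
  by apply: (measurableT_comp m1).
rewrite ge0_integral_pushforward//; last first.
  by move=> z _; rewrite mule_ge0// lee_fin ?expR_ge0.
  exact: (measurable_gauss_pair (rho t) p).
rewrite preimage_setT.
pose K v := N [set u | A (rho t * v + p * u)].
have mlin : measurable_fun setT (fun q : R * R => rho t * q.1 + p * q.2).
  by apply: measurable_funD; exact: measurable_funM.
have mS : measurable [set q : R * R | A (rho t * q.1 + p * q.2)].
  by rewrite -[X in measurable X]setTI; exact: mlin.
have mlin' (lm : R) : measurable_fun setT (fun q : R * R => rho t * (q.1 + lm) + p * q.2).
  apply: measurable_funD; apply: measurable_funM => //; exact: measurable_funD.
have mS' lm : measurable [set q : R * R | A (rho t * (q.1 + lm) + p * q.2)].
  by rewrite -[X in measurable X]setTI; exact: mlin'.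
have KE lm v : N (xsection [set q | A (rho t * (q.1 + lm) + p * q.2)] v) = K (v + lm).
  by apply: (f_equal N); apply/seteqP; split => u /=; rewrite /xsection/= inE.
have mK : measurable_fun setT K.
  have := @measurable_fun_xsection _ _ _ _ _ N _ (mS' 0).
  by rewrite (_ : _ \o _ = K)//; apply/funext => v; rewrite /= KE addr0.
have mgp := measurableT_comp mg (measurable_gauss_pair (rho t) p).
rewrite fubini_tonelli1//; last first.
  by move=> z; rewrite mule_ge0// lee_fin ?expR_ge0.
transitivity (\int[N]_v ((tilt_density lam v)%:E * K v))%E.
  apply: eq_integral => v _; rewrite /fubini_F/=.
  rewrite ge0_integralZl//; last 2 first.
  - apply: (measurableT_comp m1).
    exact: (measurableT_comp mlin (measurable_pair1 v)).
  - by rewrite lee_fin expR_ge0.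
  congr (_ * _)%E.
  transitivity (\int[N]_u (\1_[set u | A (rho t * v + p * u)] u)%:E)%E.
    apply: eq_integral => u _; rewrite /= !indicE.
    suff -> : (rho t * v + p * u \in A) = (u \in [set u | A (rho t * v + p * u)]) by [].
    by apply/idP/idP; rewrite !inE.
  rewrite integral_indic//; first by rewrite setIT.
  rewrite -[X in measurable X]setTI.
  exact: (measurableT_comp mlin (measurable_pair1 v)).
rewrite normal_tilt//.
have <- : (N \x N)%E [set q | A (rho t * (q.1 + lam) + p * q.2)] =
    (\int[N]_v K (v + lam)%R)%E.
  by apply: eq_integral => v _; rewrite /= KE.
(* Shifting [q.1] by [lam] moves the linear form by [lam * rho t]. Once this shift is absorbed in
   the set, a centred form of variance [p^2 + rho(t)^2 = t^(2H)] remains. *)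
pose A' := (fun y => y + lam * rho t) @^-1` A.
have -> : [set q | A (rho t * (q.1 + lam) + p * q.2)] =
    [set q | A' (rho t * q.1 + p * q.2)].
  by apply/funext => q; rewrite /A' /preimage /mkset /=; congr (A _); ring.
have mA' : measurable A'.
  rewrite -[X in measurable X]setTI.
  by have := @measurable_funD _ _ _ setT id (cst (lam * rho t)); apply.
have tH0 : t `^ H != 0 by rewrite gt_eqF// powR_gt0.
rewrite (normal_prob_rotation _ _ mA') [RHS](normal_prob_affine _ tH0 mA).
apply: (f_equal N); apply/funext => u; rewrite /A' /preimage /mkset /=.
by rewrite pE powR_double ?ltW// sqrtr_sqr ger0_norm ?powR_ge0.
Qed.

End fbm_tilt.

(** * Integration over row vectors *)

Section lebesgue_rV_theory.
Context (R : realType).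
Local Notation mu := (@lebesgue_measure R).

Lemma integral_lebesgue_rVS n (h : 'rV[R]_n.+1 -> \bar R) :
  measurable_fun setT h -> (forall y, 0 <= h y)%E ->
  (\int[lebesgue_rV R n.+1]_y h y =
   \int[mu]_a \int[lebesgue_rV R n]_v h (rV_cons (a, v)))%E.
Proof.
move=> mh h0; have mc := @measurable_rV_cons R n.
have mhc := measurableT_comp mh mc.
transitivity (\int[mu \x lebesgue_rV R n]_p h (rV_cons p))%E.
  by rewrite [LHS]ge0_integral_pushforward// preimage_setT.
by rewrite [LHS]fubini_tonelli1.
Qed.

Lemma measurable_lebesgue_rVS n (h : 'rV[R]_n.+1 -> \bar R) :
  measurable_fun setT h -> (forall y, 0 <= h y)%E ->
  measurable_fun setT (fun a : R => \int[lebesgue_rV R n]_v h (rV_cons (a, v)))%E.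
Proof.
move=> mh h0; have mhc := measurableT_comp mh (@measurable_rV_cons R n).
exact: (@measurable_fun_fubini_tonelli_F _ _ _ _ R (lebesgue_rV R n) _ mhc (fun p => h0 _)).
Qed.

Lemma measurable_prod_coord n (k : 'I_n -> R -> R) :
  (forall i, measurable_fun setT (k i)) ->
  measurable_fun setT (fun y : 'rV[R]_n => \prod_i k i (y ord0 i)).
Proof.
move=> mk; apply: measurable_prod => i _.
exact: (measurableT_comp (mk i) (measurable_rV_coord i)).
Qed.

Lemma integral_prod_coord n (k : 'I_n -> R -> R) :
  (forall i, measurable_fun setT (k i)) -> (forall i x, 0 <= k i x) ->
  (\int[lebesgue_rV R n]_y (\prod_i k i (y ord0 i))%:E =
   \prod_(i < n) \int[mu]_x (k i x)%:E)%E.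
Proof.
move=> mk k0; elim: n => [|n IHn] in k mk k0 *.
  under eq_integral do rewrite big_ord0.
  by rewrite big_ord0 integral_cst//= diracE mem_set// mul1e.
rewrite integral_lebesgue_rVS; last 2 first.
- by apply/measurable_EFinP; exact: measurable_prod_coord.
- by move=> y; rewrite lee_fin prodr_ge0.
rewrite big_ord_recl -IHn//.
transitivity (\int[mu]_a ((k ord0 a)%:E *
   \int[lebesgue_rV R n]_v (\prod_(i < n) k (lift ord0 i) (v ord0 i))%:E))%E.
  apply: eq_integral => a _; rewrite -ge0_integralZl//; last 3 first.
  - by apply/measurable_EFinP; exact: (@measurable_prod_coord _ (fun i => k (lift ord0 i))).
  - by move=> v _; rewrite lee_fin prodr_ge0.
  - by rewrite lee_fin; exact: k0.
  apply: eq_integral => v _; rewrite big_ord_recl EFinM rV_cons0.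
  congr (_ * _%:E)%E; apply: eq_bigr => i _; by rewrite rV_consS.
rewrite ge0_integralZr//.
- by apply/measurable_EFinP; exact: mk.
- by move=> a _; rewrite lee_fin; exact: k0.
- by apply: integral_ge0 => v _; rewrite lee_fin prodr_ge0.
Qed.

Definition cylinder n (A : 'I_n -> set R) : set 'rV[R]_n :=
  [set y | forall i, A i (y ord0 i)].

Lemma measurable_cylinder n (A : 'I_n -> set R) :
  (forall i, measurable (A i)) -> measurable (cylinder A).
Proof.
move=> mA; rewrite (_ : cylinder A = \bigcap_(i in [set: 'I_n]) (@rV_coord R n i @^-1` A i)).
  apply: fin_bigcap_measurable => // i _.
  by rewrite -[X in measurable X]setTI; exact: (measurable_rV_coord i).
by apply/seteqP; split => [y yA i _|y yA i]; exact: yA.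
Qed.

Lemma measure_eq_cylinder n (m1 m2 : {measure set 'rV[R]_n -> \bar R}) :
  (m1 setT < +oo)%E ->
  (forall A : 'I_n -> set R, (forall i, measurable (A i)) ->
    m1 (cylinder A) = m2 (cylinder A)) ->
  forall S, measurable S -> m1 S = m2 S.
Proof.
move=> m1fin m12 S mS.
pose G : set (set 'rV[R]_n) := [set cylinder A | A in [set A | forall i, measurable (A i)]].
apply: (@measure_unique _ R 'rV[R]_n G (fun=> setT)) => //.
- apply/seteqP; split.
    apply: smallest_sub; first exact: smallest_sigma_algebra.
    rewrite -bigcup_seq/= => X [i _ [A mA <-]].
    apply: sub_sigma_algebra.
    exists (fun j => if j == i then A else setT); first by move=> j /=; case: ifP.
    rewrite setTI; apply/seteqP; split => y /=.
      by move=> /(_ i); rewrite eqxx.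
    by move=> yA j; case: ifPn => [/eqP ->|].
  apply: smallest_sub; first exact: sigma_algebra_measurable.
  by move=> X [A mA <-]; exact: measurable_cylinder.
- move=> _ _ [A mA <-] [A' mA' <-]; exists (fun i => A i `&` A' i).
    by move=> i; exact: measurableI.
  apply/seteqP; split => y /=; first by move=> h; split=> i; case: (h i).
  by move=> [h h'] i; split.
- by move=> _; exists (fun=> setT) => //; apply/seteqP; split.
- by apply/seteqP; split => // y _; exists 0%N.
- by move=> _ [A mA <-]; exact: m12.
Qed.

Definition normal_rV_pdf n (m : 'I_n -> R) (s : R) (y : 'rV[R]_n) : R :=
  \prod_i normal_pdf (m i) s (y ord0 i).

Lemma normal_rV_pdf_ge0 n (m : 'I_n -> R) s y : 0 <= normal_rV_pdf m s y.
Proof. by apply: prodr_ge0 => i _; exact: normal_pdf_ge0. Qed.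

Lemma measurable_normal_rV_pdf n (m : 'I_n -> R) s :
  measurable_fun setT (normal_rV_pdf m s).
Proof.
apply: (@measurable_prod_coord n (fun i => normal_pdf (m i) s)) => i.
exact: measurable_normal_pdf.
Qed.

Lemma integral_normal_rV_pdf_cylinder n (m : 'I_n -> R) s (A : 'I_n -> set R) :
  (forall i, measurable (A i)) ->
  (\int[lebesgue_rV R n]_(y in cylinder A) (normal_rV_pdf m s y)%:E =
   \prod_(i < n) normal_prob (m i) s (A i))%E.
Proof.
move=> mA.
pose k i x := normal_pdf (m i) s x * \1_(A i) x.
transitivity (\int[lebesgue_rV R n]_y (\prod_i k i (y ord0 i))%:E)%E.
  rewrite integral_mkcond; apply: eq_integral => y _; rewrite patchE.
  rewrite big_split/= -/(normal_rV_pdf m s y).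
  case: ifPn => [|yA].
    rewrite inE => yA; rewrite big1 ?mulr1// => i _.
    by rewrite indicE mem_set//; exact: yA.
  have [i Ai] : exists i, ~ A i (y ord0 i).
    by apply/existsNP => yA'; move: yA; rewrite mem_set.
  by rewrite (bigD1 i)//= indicE memNset// mul0r mulr0.
rewrite integral_prod_coord//; last 2 first.
- move=> i; apply: measurable_funM; first exact: measurable_normal_pdf.
  exact: measurable_indic.
- by move=> i x; rewrite mulr_ge0// normal_pdf_ge0.
apply: eq_bigr => i _; rewrite /normal_prob [RHS]integral_mkcond.
apply: eq_integral => x _; rewrite patchE /k indicE.
by case: ifPn; rewrite ?mulr1 ?mulr0.
Qed.

Lemma normal_rV_measure n (m : 'I_n -> R) s (nu : {measure set 'rV[R]_n -> \bar R}) :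
  (forall A : 'I_n -> set R, (forall i, measurable (A i)) ->
    nu (cylinder A) = \prod_(i < n) normal_prob (m i) s (A i))%E ->
  forall S, measurable S ->
    nu S = (\int[lebesgue_rV R n]_(y in S) (normal_rV_pdf m s y)%:E)%E.
Proof.
move=> nuE; have [nu' nu'E] := @density_measure _ _ _ (lebesgue_rV R n) _
  (measurable_normal_rV_pdf m s) (normal_rV_pdf_ge0 m s).
move=> S mS; rewrite -nu'E; apply: measure_eq_cylinder => //; last first.
  by move=> A mA; rewrite nuE// nu'E integral_normal_rV_pdf_cylinder.
have -> : setT = cylinder (fun=> setT) :> set 'rV[R]_n by apply/seteqP; split.
rewrite nuE// big1 ?ltry// => i _.
exact: (@probability_setT _ _ _ (normal_prob (m i) s)).
Qed.

Lemma measurable_addl_rV n (x : 'rV[R]_n) : measurable_fun setT (fun y : 'rV[R]_n => x + y).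
Proof.
apply: measurable_fun_rVP => i; under eq_fun do rewrite mxE.
by apply: measurable_funD => //; exact: (measurable_rV_coord i).
Qed.

Lemma ge0_integral_lebesgue_rV_shift n (x : 'rV[R]_n) (h : 'rV[R]_n -> \bar R) :
  measurable_fun setT h -> (forall y, 0 <= h y)%E ->
  (\int[lebesgue_rV R n]_y h (x + y)%R = \int[lebesgue_rV R n]_y h y)%E.
Proof.
elim: n => [|n IHn] in x h *.
  by move=> _ _; apply: eq_integral => y _; rewrite thinmx0 [y]thinmx0.
move=> mh h0.
have mhx := measurableT_comp mh (measurable_addl_rV x).
rewrite (integral_lebesgue_rVS mhx (fun y => h0 _)) (integral_lebesgue_rVS mh h0).
pose F a := (\int[lebesgue_rV R n]_v h (rV_cons (a, v)))%E.
have F0 a : (0 <= F a)%E by apply: integral_ge0.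
have mF : measurable_fun setT F by exact: measurable_lebesgue_rVS.
rewrite [RHS](@ge0_integral_affine _ 1 (x ord0 ord0))//.
rewrite normr1 mul1e; apply: eq_integral => a _.
rewrite /F -[RHS](IHn (\row_i x ord0 (lift ord0 i))); last 2 first.
- exact: (measurableT_comp (measurableT_comp mh (@measurable_rV_cons R n))
    (measurable_pair1 _)).
- by move=> v; exact: h0.
apply: eq_integral => v _; congr h; apply/rowP => i; rewrite mxE.
have [j ->|->] := unliftP ord0 i; last by rewrite !rV_cons0 mul1r addrC.
by rewrite !rV_consS !mxE.
Qed.

End lebesgue_rV_theory.

(** * Exponential change of measure for the vector process *)

Section fbm_tilt_rV.
Context (R : realType) (disp : measure_display) (T : measurableType disp).
Variables (P : probability T R) (H : R) (n : nat) (B : R -> T -> 'rV[R]_n.+1).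
Hypotheses (H0 : 0 < H) (fB : fractional_brownian_motion P H B).
Local Notation N := (@normal_prob R 0 1).
Local Notation rho t := (fbm_cov H t 1).
Local Notation coord i t := (fun w => B t w ord0 i).

(** Since the first coordinate at time 1 has variance 1, the term [lam^2 / 2] normalizes this to a
    probability density, see [integral_tilt]. *)
Definition tilt (lam : R) (w : T) : R :=
  expR (lam * B 1 w ord0 ord0 - lam ^+ 2 / 2).

Let fB1 i : fractional_brownian_motion1 P H (fun t w => B t w ord0 i).
Proof. by case: fB => + _; apply. Qed.

Lemma measurable_tilt lam : measurable_fun setT (tilt lam).
Proof.
apply: measurableT_comp => //; apply: measurable_funB => //.
by apply: measurable_funM => //; exact: (measurable_fbm (fB1 ord0) ler01).
Qed.

Let fbm_law0 i (t : R) (A : set R) : 0 < t -> measurable A ->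
  P (coord i t @^-1` A) = normal_prob 0 (t `^ H) A.
Proof.
move=> t0 mA.
have [_ lawE] := fbm_linear_law H0 (fB1 i) 1 0 (ltW t0) (ltW t0).
rewrite [RHS]normal_prob_affine//; last by rewrite gt_eqF// powR_gt0.
rewrite (_ : _ @^-1` _ = [set w | A (1 * B t w ord0 i + 0 * B t w ord0 i)]).
  rewrite lawE//; apply: (f_equal N); apply/funext => u; rewrite /preimage /mkset/=.
  rewrite expr1n !mul1r !(mulr0, mul0r) expr0n mul0r !addr0 powR_double ?ltW//.
  by rewrite sqrtr_sqr ger0_norm ?powR_ge0.
by apply/funext => w; rewrite /preimage /mkset/= mul1r mul0r addr0.
Qed.

(** [independent_processes] speaks of events of the process sigma-algebras, so events of the pair at
    times [t] and 1 must be placed in that of the first coordinate. This is done by proving the pair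
    measurable on [T] with the generated sigma-algebra. *)
Let pair_sigma_algebra (t : R) (S : set (R * R)) : 0 <= t -> measurable S ->
  process_sigma_algebra (fun t w => B t w ord0 ord0)
    [set w | S (B t w ord0 ord0, B 1 w ord0 ord0)].
Proof.
move=> t0 mS; rewrite /process_sigma_algebra; set G := \bigcup_(t in _) _.
have mX (r : R) : 0 <= r -> measurable_fun (setT : set (g_sigma_algebraType G))
    (coord ord0 r : g_sigma_algebraType G -> R).
  move=> r0 _ A mA; rewrite setTI; apply: sub_sigma_algebra.
  by exists r => //; exists A => //; rewrite setTI.
have mp : measurable_fun (setT : set (g_sigma_algebraType G))
    (fun w : g_sigma_algebraType G => (B t w ord0 ord0, B 1 w ord0 ord0)).
  by apply/measurable_fun_pairP; split; exact: mX.
by have := mp measurableT S mS; rewrite setTI.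
Qed.

(** The weight involves the first coordinate only. By independence, the image under the pair of [P]
    restricted to the event [F] of the other coordinates is the law of the pair scaled by the
    probability of [F]. *)
Lemma fbm_tilt_cylinder (t lam : R) (A : 'I_n.+1 -> set R) : 0 < t ->
  (forall i, measurable (A i)) ->
  (\int[P]_(w in B t @^-1` cylinder A) (tilt lam w)%:E =
   \prod_(i < n.+1) normal_prob (lam * rho t * (i == ord0)%:R) (t `^ H) (A i))%E.
Proof.
move=> t0 mA; have [_ indB] := fB.
pose F := [set w | forall i : 'I_n, A (lift ord0 i) (B t w ord0 (lift ord0 i))].
have mF : measurable F.
  rewrite (_ : F = \bigcap_(i in [set: 'I_n]) (coord (lift ord0 i) t @^-1` A (lift ord0 i))).
    apply: fin_bigcap_measurable => // i _; rewrite -[X in measurable X]setTI.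
    by apply: (measurable_fbm (fB1 _) (ltW t0)).
  by apply/seteqP; split => [w wF i _|w wF i]; exact: wF.
have PSF S : measurable S ->
    (P ([set w | S (B t w ord0 ord0, B 1 w ord0 ord0)] `&` F) =
     P [set w | S (B t w ord0 ord0, B 1 w ord0 ord0)] *
     \prod_(i < n) normal_prob 0 (t `^ H) (A (lift ord0 i)))%E.
  move=> mS.
  (* One event per coordinate: the pair event for the first one, an event at time [t] for each of
     the others. *)
  pose E (i : 'I_n.+1) := if i == ord0 then [set w | S (B t w ord0 ord0, B 1 w ord0 ord0)]
     else coord i t @^-1` A i.
  have := indB E; rewrite big_ord_recl.
  rewrite (_ : \bigcap_i E i = [set w | S (B t w ord0 ord0, B 1 w ord0 ord0)] `&` F).
    move=> ->; last first.
      move=> i; rewrite /E; case: ifPn => [/eqP ->|_].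
        by apply: pair_sigma_algebra => //; exact: ltW.
      apply: sub_sigma_algebra; exists t; first exact: ltW.
      by exists (A i) => //; rewrite setTI.
    rewrite {1}/E eqxx; congr (_ * _)%E; apply: eq_bigr => i _.
    by rewrite /E fbm_law0.
  apply/seteqP; split => [w wE|w [wS wF] i _].
    split; first by have := wE ord0 I; rewrite /E eqxx.
    by move=> i; have := wE (lift ord0 i) I; rewrite /E.
  by rewrite /E; have [j ->|->] := unliftP ord0 i.
have [law lawE tiltE] := fbm_tilt_law H0 (fB1 ord0) lam t0 (mA ord0).
rewrite big_ord_recl/= mulr1.
under eq_bigr do rewrite mulr0.
rewrite -[X in _ = (X * _)%E]tiltE.
set pF := (\prod_(i < n) _)%E.
have pF0 : (0 <= pF)%E by apply: prode_ge0 => i _; exact: measure_ge0.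
have pFfin : pF \is a fin_num.
  apply: prode_fin_num => i _.
  exact: (@fin_num_measure _ _ _ (normal_prob 0 (t `^ H)) _ (mA _)).
pose pf : {nonneg R} := NngNum (fine_ge0 pF0).
have mXX : measurable_fun setT (fun w => (B t w ord0 ord0, B 1 w ord0 ord0)).
  apply/measurable_fun_pairP; split; first exact: (measurable_fbm (fB1 ord0) (ltW t0)).
  exact: (measurable_fbm (fB1 ord0) ler01).
pose lawX : {measure set (R * R) -> \bar R} :=
  measure_function_pushforward__canonical__measure_function_Measure (mrestr P mF) mXX.
pose g (z : R * R) : \bar R := ((expR (lam * z.2 - lam ^+ 2 / 2))%:E * (\1_(A ord0) z.1)%:E)%E.
have mg : measurable_fun setT g.
  apply: emeasurable_funM; apply/measurable_EFinP.
    by apply: (measurableT_comp (measurable_tilt_density lam)).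
  by apply: (measurableT_comp (measurable_indic (mA ord0))).
have g0 z : (0 <= g z)%E by rewrite mule_ge0// lee_fin ?expR_ge0.
transitivity (\int[lawX]_z g z)%E; last first.
  transitivity (\int[mscale pf law]_z g z)%E.
    apply: eq_measure_integral => S mS _.
    rewrite /lawX/= /pushforward /mrestr /mscale/= fineK// muleC -lawE//.
    exact: PSF.
  by rewrite ge0_integral_mscale//= fineK// muleC.
rewrite ge0_integral_pushforward// preimage_setT.
have mF1 : measurable_fun setT (\1_F : T -> R) by exact: measurable_indic.
have F10 w : 0 <= (\1_F w : R) by [].
(* Restricting [P] to [F] amounts to weighing it by the indicator of [F]. *)
rewrite (@ge0_integral_density _ _ _ P _ mF1 F10 (mrestr P mF))//; last 3 first.
- by move=> S mS; rewrite /mrestr integral_indic// setIC.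
- exact: measurableT_comp mg mXX.
- by move=> w; exact: g0.
rewrite [LHS]integral_mkcond; apply: eq_integral => w _; rewrite patchE /g/= !indicE.
have -> : (w \in B t @^-1` cylinder A) = (B t w ord0 ord0 \in A ord0) && (w \in F).
  apply/idP/andP; rewrite !inE.
    by move=> wA; split => [|i]; exact: wA.
  by move=> [w0 wF] i; have [j ->|->] := unliftP ord0 i.
case: (_ \in A ord0); case: (_ \in F); rewrite ?mule1 ?mule0//.
Qed.

(** Cylinders determine the image under [x + B t] of the weighted probability [Q], so its density
    follows from [fbm_tilt_cylinder] once the sets are translated by [x]. *)
Lemma fbm_tilt_integral (t lam : R) (x : 'rV[R]_n.+1) (h : 'rV[R]_n.+1 -> \bar R) :
  0 < t -> measurable_fun setT h -> (forall y, 0 <= h y)%E ->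
  (\int[P]_w (h (x + B t w)%R * (tilt lam w)%:E) =
   \int[lebesgue_rV R n.+1]_y (h y *
     (normal_rV_pdf (fun i => x ord0 i + lam * rho t * (i == ord0)%:R) (t `^ H) y)%:E))%E.
Proof.
move=> t0 mh h0.
have tH0 : t `^ H != 0 by rewrite gt_eqF// powR_gt0.
have tilt0 w : 0 <= tilt lam w by exact: expR_ge0.
have [Q QE] := density_measure P (measurable_tilt lam) tilt0.
have mxB : measurable_fun setT (fun w => x + B t w).
  apply: measurable_fun_rVP => i; under eq_fun do rewrite mxE.
  by apply: measurable_funD => //; exact: (measurable_fbm (fB1 i) (ltW t0)).
pose nu : {measure set 'rV[R]_n.+1 -> \bar R} :=
  measure_function_pushforward__canonical__measure_function_Measure Q mxB.
pose m (i : 'I_n.+1) := x ord0 i + lam * rho t * (i == ord0)%:R.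
have nuE (A : 'I_n.+1 -> set R) : (forall i, measurable (A i)) ->
    (nu (cylinder A) = \prod_(i < n.+1) normal_prob (m i) (t `^ H) (A i))%E.
  move=> mA; pose A' i := (fun u => 1 * u + x ord0 i) @^-1` A i.
  have mA' i : measurable (A' i).
    by rewrite -[X in measurable X]setTI; exact: measurable_affine.
  rewrite /nu/= /pushforward (_ : _ @^-1` _ = B t @^-1` cylinder A'); last first.
    apply/seteqP; split => w /= wA i; have := wA i; rewrite /A'/= mxE mul1r addrC//.
  rewrite QE (fbm_tilt_cylinder lam t0 mA'); apply: eq_bigr => i _.
  rewrite [LHS](normal_prob_affine _ tH0 (mA' i)) [RHS](normal_prob_affine _ tH0 (mA i)).
  apply: (f_equal N); apply/funext => u; rewrite /A' /preimage /mkset/=.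
  by congr (A _ _); rewrite /m; ring.
rewrite -(@ge0_integral_density _ _ _ (lebesgue_rV R n.+1) _
  (measurable_normal_rV_pdf m (t `^ H)) (normal_rV_pdf_ge0 m (t `^ H)) nu h
  (normal_rV_measure nuE) mh h0).
rewrite [RHS]ge0_integral_pushforward// preimage_setT.
rewrite (@ge0_integral_density _ _ _ P _ (measurable_tilt lam) tilt0 Q)//.
- exact: (measurableT_comp mh mxB).
- by move=> w; exact: h0.
Qed.

End fbm_tilt_rV.

(** * Joint measurability *)

Section continuous_process.
Context (R : realType) (d : measure_display) (T : measurableType d).
Variable X : R -> T -> R.
Hypothesis mX : forall t, 0 <= t -> measurable_fun setT (X t).
Hypothesis cX : forall w, {within `[0, +oo[, continuous (fun t => X t w)}.

(** The path sampled at the last grid point of step [1/(n+1)] before the given time. As [truncn]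
    sends negative numbers to 0, negative times are sampled at 0, in accordance with the clipping
    [Num.max p.2 0] of the limit. *)
Let Xn (n : nat) (p : T * R) : R :=
  X ((Num.truncn (n.+1%:R * p.2))%:R / n.+1%:R) p.1.

Let measurable_truncn_eq (c : R) (k : nat) : measurable [set t : R | Num.truncn (c * t) = k].
Proof.
have mc : measurable_fun setT (fun t : R => c * t) by exact: measurable_funM.
have [D [mD DE]] : exists D : set R, measurable D /\
    forall x, D x <-> Num.truncn x = k.
  (* The level set of 0 extends to minus infinity, [truncn] being 0 on negative numbers. *)
  case: k => [|k].
    exists `]-oo, 1[%classic; split; first exact: measurable_itv.
    move=> x; rewrite /= in_itv/= -[1]/(1%:R) -truncn_le_nat leqn0.
    by split => [/eqP|/eqP].
  exists `[k.+1%:R, k.+2%:R[%classic; split; first exact: measurable_itv.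
  move=> x; rewrite /= in_itv/= -truncn_gt_nat -truncn_le_nat.
  split=> [/andP[h1 h2]|->]; last by rewrite !leqnn.
  by apply/eqP; rewrite eqn_leq h2.
rewrite (_ : [set _ | _] = (fun t : R => c * t) @^-1` D).
  by rewrite -[X in measurable X]setTI; exact: mc.
by apply/seteqP; split => t /= /DE.
Qed.

Let measurable_Xn n : measurable_fun setT (Xn n).
Proof.
move=> _ A mA; rewrite setTI.
rewrite (_ : _ @^-1` _ = \bigcup_k ((X (k%:R / n.+1%:R) @^-1` A) `*`
    [set t | Num.truncn (n.+1%:R * t) = k])); last first.
  apply/seteqP; split => [[w t] /= XA|[w t] [k _ [/= XA tk]]].
    by exists (Num.truncn (n.+1%:R * t)).
  by rewrite /preimage/= /Xn/= tk.
apply: bigcupT_measurable => k; apply: measurableX => //.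
rewrite -[X in measurable X]setTI; exact: mX.
Qed.

Lemma measurable_continuous_process :
  measurable_fun setT (fun p : T * R => X (Num.max p.2 0) p.1).
Proof.
apply: (measurable_fun_cvg (h := Xn)) => //= -[w t] _ /=.
pose u n : R := (Num.truncn (n.+1%:R * t))%:R / n.+1%:R.
have u0 n : 0 <= u n by rewrite divr_ge0.
have ut : u n @[n --> \oo] --> Num.max t 0.
  have [t0|t0] := leP 0 t; last first.
    rewrite (_ : u = fun=> 0); first exact: cvg_cst.
    apply/funext => n; rewrite /u.
    have -> : Num.truncn (n.+1%:R * t) = 0%N.
      apply/eqP; rewrite -leqn0 truncn_le_nat (le_lt_trans _ ltr01)//.
      by rewrite pmulr_rle0// ltW.
    by rewrite mul0r.
  apply: (@squeeze_cvgr _ _ _ _ (fun n => t - harmonic n) (fun=> t)).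
  - apply: nearW => n; have n0 : (0 : R) < n.+1%:R by [].
    have /truncn_itv/andP[h1 h2] : 0 <= n.+1%:R * t by rewrite mulr_ge0.
    rewrite /u /harmonic /= ler_pdivrMr// [t * _]mulrC h1 andbT.
    rewrite ler_pdivlMr// mulrBl mulVf ?gt_eqF// [t * _]mulrC lerBlDr natr1.
    exact: ltW.
  - have : t - @harmonic R n @[n --> \oo] --> t - 0.
      by apply: cvgB; [exact: cvg_cst|exact: cvg_harmonic].
    by rewrite subr0.
  - exact: cvg_cst.
have m0 : 0 <= Num.max t 0 by rewrite le_max lexx orbT.
(* Continuity holds within [[0, +oo[] only; the grid points [u n] stay there, so the limit may be
   taken along them. *)
have /subspace_continuousP/(_ (Num.max t 0)) := cX (w := w).
rewrite /= in_itv/= andbT m0 => /(_ isT) h.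
apply: (cvg_comp u _ _ h) => V /= tV.
have : nbhs \oo (u @^-1` [set y | `[0, +oo[%classic y -> V y]) := ut _ tV.
by apply: filterS => n; apply; rewrite /= in_itv/= andbT; exact: u0.
Qed.

End continuous_process.

(** * The time integral of the Gaussian kernel *)

Section gamma_substitution.
Context (R : realType).
Local Notation mu := (@lebesgue_measure R).

Lemma continuous_powR_gt0 (p x : R) : 0 < x -> {for x, continuous (@powR R ^~ p)}.
Proof.
move=> x0; apply/differentiable_continuous/derivable1_diffP.
by apply: derivable_powR; rewrite in_itv/= x0.
Qed.

(** The substitution is [u = r * t^(-a)], which is decreasing. It is made on the compact intervals
    [[1/(n+2), n+2]] and extended by monotone convergence, so both sides may be infinite. *)
Lemma gamma_substitution (a r z : R) : 0 < a -> 0 < r ->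
  (\int[mu]_(t in `]0%R, +oo[) (t `^ (- a * z - 1) * expR (- (r * t `^ (- a))))%:E =
   (a^-1 * r `^ (- z))%:E *
   \int[mu]_(u in `]0%R, +oo[) (u `^ (z - 1) * expR (- u))%:E)%E.
Proof.
move=> a0 r0.
pose F (t : R) := r * t `^ (- a); pose G (u : R) := u `^ (z - 1) * expR (- u).
pose f t := t `^ (- a * z - 1) * expR (- (r * t `^ (- a))).
have measurable_fT : measurable_fun setT (fun t => (f t)%:E).
  apply/measurable_EFinP; apply: measurable_funM; first exact: measurable_powR.
  apply: measurableT_comp => //; apply: measurableT_comp => //.
  by apply: measurable_funM => //; exact: measurable_powR.
have dF (t : R) : 0 < t -> is_derive t 1 F (- a * r * t `^ (- a - 1)).
  move=> t0; have h := is_derive1_powR (- a) t0.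
  have -> : F = r \*: (@powR R ^~ (- a)) by apply/funext => u.
  apply: is_derive_eq; rewrite /GRing.scale/=; ring.
have dFE (t : R) : 0 < t -> F^`()%classic t = - a * r * t `^ (- a - 1).
  by move=> t0; rewrite derive1E; have := dF _ t0 => -[].
have cF' (t : R) : 0 < t -> F^`()%classic x @[x --> t] --> - a * r * t `^ (- a - 1).
  move=> t0; apply: cvg_trans (_ : - a * r * x `^ (- a - 1) @[x --> t] --> _).
    apply: near_eq_cvg; near=> x; rewrite dFE//; near: x; exact: lt_nbhsr.
  by apply: cvgM; [exact: cvg_cst|exact: continuous_powR_gt0].
have cF (t : R) : 0 < t -> {for t, continuous F}.
  move=> t0; apply/differentiable_continuous/derivable1_diffP.
  by case: (dF _ t0).
have cG (u : R) : 0 < u -> {for u, continuous G}.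
  move=> u0; apply: cvgM; first exact: continuous_powR_gt0.
  by apply: (@continuous_comp _ _ _ -%R expR); [exact: opp_continuous|exact: continuous_expR].
have decF (s t : R) : 0 < s -> s < t -> F t < F s.
  move=> s0 st; rewrite /F ltr_pM2l// !powRN ltf_pV2//.
    by apply: gt0_ltr_powR => //; rewrite nnegrE ltW//; exact: lt_trans st.
  by rewrite posrE powR_gt0//; exact: lt_trans st.
  by rewrite posrE powR_gt0.
have F0 (t : R) : 0 < t -> 0 < F t by move=> t0; rewrite mulr_gt0 ?powR_gt0.
have pD (x p q : R) : 0 < x -> x `^ p * x `^ q = x `^ (p + q).
  by move=> x0; rewrite powRD// (gt_eqF x0) implybT.
have GF (t : R) : 0 < t -> ((G \o F) * - F^`()%classic) t = (a * r `^ z) * f t.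
  move=> t0; rewrite -[LHS]/(G (F t) * - F^`()%classic t) dFE// /G /F /f.
  rewrite powRM ?powR_ge0 ?ltW// -powRrM.
  set e := expR _.
  have -> : r `^ (z - 1) * t `^ (- a * (z - 1)) * e * - (- a * r * t `^ (- a - 1)) =
     a * (r * r `^ (z - 1)) * (t `^ (- a * (z - 1)) * t `^ (- a - 1)) * e by ring.
  rewrite -{1}[r]powRr1 ?ltW// !pD// -!mulrA.
  by congr (_ * (_ `^ _ * (_ `^ _ * _))); ring.
pose A (n : nat) : R := n.+2%:R^-1; pose b (n : nat) : R := n.+2%:R.
have A0 n : 0 < A n by rewrite invr_gt0.
have Ab n : A n <= b n.
  by rewrite (@le_trans _ _ 1)// ?invf_le1 ?ler1n.
have b0 n : 0 < b n by [].
have sub n : (\int[mu]_(x in `[F (b n), F (A n)]) (G x)%:E =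
    (a * r `^ z)%:E * \int[mu]_(x in `[A n, b n]) (f x)%:E)%E.
  rewrite (integration_by_substitution_decreasing (Ab n)).
  - rewrite -ge0_integralZl//; last 3 first.
    + exact: measurable_funTS.
    + by move=> x _; rewrite lee_fin mulr_ge0 ?powR_ge0 ?expR_ge0.
    + by rewrite lee_fin mulr_ge0 ?powR_ge0 ?ltW.
    apply: eq_integral => x; rewrite inE/= in_itv/= => /andP[Ax _].
    by rewrite GF ?EFinM// (lt_le_trans (A0 n)).
  - move=> x y; rewrite !in_itv/= => /andP[Ax _] /andP[Ay _] xy.
    by apply: decF => //; exact: lt_le_trans (A0 n) Ay.
  - move=> x; rewrite in_itv/= => /andP[Ax _].
    have x0 := lt_trans (A0 n) Ax.
    by rewrite /continuous_at dFE//; exact: cF'.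
  - apply/cvg_ex; exists (- a * r * A n `^ (- a - 1)).
    by apply: cvg_at_right_filter; exact: cF'.
  - apply/cvg_ex; exists (- a * r * b n `^ (- a - 1)).
    by apply: cvg_at_left_filter; exact: cF'.
  - split.
    + move=> x; rewrite in_itv/= => /andP[Ax _].
      by case: (dF _ (lt_trans (A0 n) Ax)).
    + by apply: cvg_at_right_filter; exact: cF.
    + by apply: cvg_at_left_filter; exact: cF.
  - apply: continuous_in_subspaceT => x; rewrite inE/= in_itv/= => /andP[Fx _].
    by apply: cG; exact: lt_le_trans (F0 _ (b0 n)) Fx.
have exn (t : R) : 0 < t -> exists n, A n <= t <= b n.
  move=> t0; exists (maxn (Num.truncn t) (Num.truncn t^-1)); apply/andP; split.
    rewrite -[leRHS]invrK lef_pV2 ?posrE ?invr_gt0// ltW//.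
    rewrite (lt_le_trans (truncnS_gt _))// ler_nat.
    by rewrite ltnS leqW// leq_maxr.
  rewrite ltW// (lt_le_trans (truncnS_gt _))// ler_nat.
  by rewrite ltnS leqW// leq_maxl.
have decFle (s t : R) : 0 < s -> s <= t -> F t <= F s.
  by move=> s0; rewrite le_eqVlt => /predU1P[->//|st]; exact/ltW/decF.
pose I1 n : set R := `[A n, b n]%classic.
pose I2 n : set R := `[F (b n), F (A n)]%classic.
have bS (m n : nat) : (m <= n)%N -> b m <= b n by move=> mn; rewrite ler_nat !ltnS.
have AS (m n : nat) : (m <= n)%N -> A n <= A m.
  by move=> mn; rewrite lef_pV2 ?posrE// bS.
have ndI1 : nondecreasing_seq I1.
  by move=> m n mn; apply/subsetPset; apply: subset_itv; rewrite leBSide/= ?bS ?AS.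
have ndI2 : nondecreasing_seq I2.
  move=> m n mn; apply/subsetPset; apply: subset_itv; rewrite leBSide/=;
  by apply: decFle => //; rewrite ?bS ?AS.
have UI1 : \bigcup_n I1 n = `]0, +oo[%classic.
  apply/seteqP; split => [t [n _]|t] /=; rewrite !in_itv/= ?andbT.
    by move=> /andP[At _]; exact: lt_le_trans (A0 n) At.
  by move=> /exn[n nt]; exists n => //; rewrite /I1/= in_itv.
have UI2 : \bigcup_n I2 n = `]0, +oo[%classic.
  apply/seteqP; split => [t [n _]|u] /=; rewrite !in_itv/= ?andbT.
    by move=> /andP[At _]; exact: lt_le_trans (F0 _ (b0 n)) At.
  (* The inverse of the substitution, at [u]. *)
  move=> u0; pose t := (u / r) `^ (- a^-1).
  have t0 : 0 < t by rewrite powR_gt0// divr_gt0.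
  have Ft : F t = u.
    rewrite /F /t -powRrM mulrNN mulVf ?gt_eqF// powRr1 ?divr_ge0 ?ltW//.
    by rewrite mulrCA divff ?mulr1 ?gt_eqF.
  have [n /andP[n1 n2]] := exn _ t0; exists n => //.
  by rewrite /I2/= in_itv/= -Ft !decFle.
have G0 u : (0 <= (G u)%:E)%E by rewrite lee_fin mulr_ge0 ?powR_ge0 ?expR_ge0.
have f0 u : (0 <= (f u)%:E)%E by rewrite lee_fin mulr_ge0 ?powR_ge0 ?expR_ge0.
have mG : measurable_fun setT (fun u => (G u)%:E).
  apply/measurable_EFinP; apply: measurable_funM; first exact: measurable_powR.
  by apply: measurableT_comp => //; exact: measurableT_comp.
have c1 := @ge0_nondecreasing_set_cvg_integral _ (measurableTypeR R) _ I1 _ mu ndI1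
  (fun n => measurable_itv _) (fun n => measurable_funTS measurable_fT) (fun n x _ => f0 x).
have c2 := @ge0_nondecreasing_set_cvg_integral _ (measurableTypeR R) _ I2 _ mu ndI2
  (fun n => measurable_itv _) (fun n => measurable_funTS mG) (fun n x _ => G0 x).
rewrite UI1 in c1; rewrite UI2 in c2.
have c0 : a * r `^ z != 0 by rewrite mulf_neq0 ?gt_eqF// powR_gt0.
have c3 : (\int[mu]_(u in I2 n) (G u)%:E @[n --> \oo] -->
   (a * r `^ z)%:E * \int[mu]_(t in `]0%R, +oo[) (f t)%:E)%E.
  under eq_fun do rewrite /I2 sub.
  by apply: cvgeZl.
have -> := cvg_unique _ c2 c3 => //.
rewrite muleA -EFinM powRN (_ : a^-1 * (r `^ z)^-1 * (a * r `^ z) = 1) ?mul1e//.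
by field; rewrite !gt_eqF ?powR_gt0.
Unshelve. all: by end_near. Qed.

End gamma_substitution.

Section gaussian_kernel.
Context (R : realType).
Local Notation mu := (@lebesgue_measure R).

(** The centred density of [B t], arranged in powers of [t] so that its time integral is an instance
    of [gamma_substitution]. *)
Definition gaussian_kernel n (H t : R) (y : 'rV[R]_n) : R :=
  (2 * pi) `^ (- (n%:R / 2)) *
  (t `^ (- (n%:R * H)) * expR (- (euclid_norm y ^+ 2 / 2 * t `^ (- (2 * H))))).

Lemma euclid_norm_sqr n (y : 'rV[R]_n) : euclid_norm y ^+ 2 = \sum_i y ord0 i ^+ 2.
Proof. by rewrite sqr_sqrtr// sumr_ge0// => i _; exact: sqr_ge0. Qed.

Lemma euclid_norm_gt0 n (y : 'rV[R]_n) : y != 0 -> 0 < euclid_norm y.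
Proof.
move=> y0; rewrite lt_neqAle eq_sym sqrtr_ge0 andbT.
apply: contra y0 => /eqP ny0; apply/eqP/rowP => i; rewrite mxE; apply/eqP.
rewrite -sqrf_eq0; have := euclid_norm_sqr y; rewrite ny0 expr0n/= => /esym/eqP.
by rewrite psumr_eq0; [move=> /allP/(_ i); rewrite mem_index_enum => /(_ isT)|move=> j _; exact: sqr_ge0].
Qed.

Lemma normal_peakE (t H : R) : 0 < t ->
  normal_peak (t `^ H) = (2 * pi) `^ (- 2^-1) * t `^ (- H).
Proof.
move=> t0; rewrite /normal_peak -mulrnAr sqrtrM ?sqr_ge0// sqrtr_sqr.
rewrite ger0_norm ?powR_ge0// invfM -powRN mulrC; congr (_ * _).
by rewrite powRN -mulr_natl powR12_sqrt// mulr_ge0// pi_ge0.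
Qed.

Lemma normal_peak_exp n (t H : R) : 0 < t ->
  normal_peak (t `^ H) ^+ n = (2 * pi) `^ (- (n%:R / 2)) * t `^ (- (n%:R * H)).
Proof.
move=> t0; rewrite normal_peakE// exprMn -!powR_mulrn ?powR_ge0// -!powRrM.
by congr (_ `^ _ * _ `^ _); ring.
Qed.

Lemma normal_rV_pdf_kernel n (H t : R) (x y : 'rV[R]_n) : 0 < t ->
  normal_rV_pdf (fun i => x ord0 i) (t `^ H) (x + y) = gaussian_kernel H t y.
Proof.
move=> t0; have tH0 : t `^ H != 0 by rewrite gt_eqF// powR_gt0.
rewrite /normal_rV_pdf /gaussian_kernel.
under eq_bigr do rewrite normal_pdfE// mxE.
rewrite big_split/= prodr_const card_ord normal_peak_exp// -[LHS]mulrA.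
congr (_ * (_ * _)); rewrite -expR_sum; congr expR.
rewrite euclid_norm_sqr powRN powR_double ?ltW// mulr_suml mulr_suml -sumrN.
by apply: eq_bigr => i _; rewrite addrAC subrr add0r; field.
Qed.

Lemma measurable_euclid_norm n : measurable_fun setT (@euclid_norm R n).
Proof.
apply: measurableT_comp; first by apply: continuous_measurable_fun; exact: sqrt_continuous.
apply: measurable_sum => i; apply: measurable_funX.
exact: (measurable_rV_coord i).
Qed.

Lemma measurable_gaussian_kernel n (H : R) :
  measurable_fun setT (fun p : R * 'rV[R]_n => gaussian_kernel H p.1 p.2).
Proof.
have mp (q : R) : measurable_fun setT (fun p : R * 'rV[R]_n => p.1 `^ q).
  by apply: (measurableT_comp (measurable_powR q)).
apply: measurable_funM => //; apply: measurable_funM => //.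
apply: measurableT_comp => //; apply: measurableT_comp => //.
apply: measurable_funM => //; apply: measurable_funM => //.
apply: measurable_funX; apply: measurableT_comp => //.
exact: measurable_euclid_norm.
Qed.

Lemma gaussian_kernel_ge0 n (H t : R) (y : 'rV[R]_n) : 0 <= gaussian_kernel H t y.
Proof. by rewrite !mulr_ge0 ?powR_ge0 ?expR_ge0. Qed.

(* C_const without its Gamma factor, whose finiteness is only deduced from that
   of the mean; as a real number Gamma would be 0 if its integral diverged. *)
Definition C_coef n (H : R) : R :=
  2 `^ (- (1 + (2 * H)^-1)) * H^-1 * pi `^ (- (n%:R / 2)).

(** The substitution is used with [a = 2H], [r = |y|^2 / 2] and [z = n/2 - 1/(2H)]; the factor
    [r^(-z)] then supplies the power [|y|^(-(n - 1/H))]. *)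
Lemma integral_gaussian_kernel n (H : R) (y : 'rV[R]_n) : 0 < H -> y != 0 ->
  (\int[mu]_(t in `]0%R, +oo[) (gaussian_kernel H t y)%:E =
   (C_coef n H / euclid_norm y `^ (n%:R - H^-1))%:E *
   \int[mu]_(u in `]0%R, +oo[) (u `^ (n%:R / 2 - (2 * H)^-1 - 1) * expR (- u))%:E)%E.
Proof.
move=> H0 y0; have ny := euclid_norm_gt0 y0.
set z := n%:R / 2 - (2 * H)^-1; set r := euclid_norm y ^+ 2 / 2.
have r0 : 0 < r by rewrite divr_gt0// exprn_gt0.
have H20 : 0 < 2 * H by rewrite mulr_gt0.
have E : - (n%:R * H) = - (2 * H) * z - 1 by rewrite /z; field; rewrite gt_eqF.
under eq_integral do rewrite /gaussian_kernel EFinM -/r E.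
rewrite ge0_integralZl; last 4 first.
- exact: measurable_itv.
- apply: measurable_funTS; apply/measurable_EFinP; apply: measurable_funM.
    exact: measurable_powR.
  apply: measurableT_comp => //; apply: measurableT_comp => //.
  by apply: measurable_funM => //; exact: measurable_powR.
- by move=> t _; rewrite lee_fin mulr_ge0 ?powR_ge0 ?expR_ge0.
- by rewrite lee_fin powR_ge0.
rewrite gamma_substitution// muleA -EFinM; congr (_%:E * _)%E.
have pi0 := pi_gt0 R.
have Er : r `^ (- z) = euclid_norm y `^ (2 * - z) * 2 `^ (-1 * - z).
  rewrite powRM ?invr_ge0 ?sqr_ge0// -powR_mulrn ?ltW// -powRrM.
  by rewrite -[2^-1]powR_inv1// -powRrM.
rewrite Er powRM ?ltW// /C_coef.
rewrite -powRN (_ : - (n%:R - H^-1) = 2 * - z); last by rewrite /z; field; rewrite gt_eqF.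
(* The powers of 2 in the constant come from [(2 pi)^(-n/2)], from [r^(-z)] and from
   [1/a = 1/(2H)]. *)
rewrite (_ : - (1 + (2 * H)^-1) = - (n%:R / 2) + (-1 * - z) + - 1); last by rewrite /z; field; rewrite gt_eqF.
have pD (x p q : R) : 0 < x -> x `^ (p + q) = x `^ p * x `^ q.
  by move=> x0; rewrite powRD// (gt_eqF x0) implybT.
rewrite !pD// [2 `^ -1]powR_inv1//; field.
by rewrite gt_eqF.
Qed.

End gaussian_kernel.

(** * Domination and support *)

Section domination.
Context (R : realType).
Local Notation mu := (@lebesgue_measure R).

(** Switching bounds at [t = 1], rather than taking the smaller one, leaves a constant and an
    explicit power to integrate. *)
Definition powR_tail (M c q : R) (t : R) : R := if t <= 1 then M else c * t `^ (- q).

Lemma measurable_powR_tail M c q : measurable_fun setT (powR_tail M c q).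
Proof.
apply: measurable_fun_ifT => //; last first.
  by apply: measurable_funM => //; exact: measurable_powR.
exact: measurable_fun_ler.
Qed.

Lemma powR_cvg_y (p : R) : 0 < p -> t `^ (- p) @[t --> +oo] --> (0 : R).
Proof.
move=> p0; apply: (@cvg_trans _ (expR (- (p * ln t)) @[t --> +oo])).
  apply: near_eq_cvg; near=> t; rewrite /powR mulNr ifF//.
  by apply/negbTE; rewrite gt_eqF//; near: t; exact: nbhs_pinfty_gt.
have h : p * ln t @[t --> +oo] --> +oo.
  apply/cvgryPge => A; near=> t.
  have At : expR (A / p) <= t by near: t; exact: nbhs_pinfty_ge.
  have tp : 0 < t := lt_le_trans (expR_gt0 _) At.
  by rewrite -ler_pdivrMl// mulrC -[leLHS]expRK ler_ln ?posrE ?expR_gt0.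
exact: (cvg_comp _ _ h (@cvgr_expR R)).
Unshelve. all: by end_near. Qed.

Lemma integrable_powR_tail M c q : 0 <= M -> 0 <= c -> 1 < q ->
  mu.-integrable `]0%R, +oo[ (fun t => (powR_tail M c q t)%:E).
Proof.
move=> M0 c0 q1; have q0 : 0 < q - 1 by rewrite subr_gt0.
have mt := measurable_powR_tail M c q.
have t0 (t : R) : 0 <= powR_tail M c q t.
  by rewrite /powR_tail; case: ifP => // _; rewrite mulr_ge0 ?powR_ge0.
apply/integrableP; split; first exact/measurable_funTS/measurable_EFinP.
under eq_integral do rewrite gee0_abs ?lee_fin//.
have U : (`]0, +oo[%classic : set R) = `]0, 1]%classic `|` `]1, +oo[%classic.
  apply/seteqP; split => t /=; rewrite !in_itv/= !andbT.
    by move=> ->; case: (leP t 1) => h; [left|right].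
  by move=> [/andP[]//|]; exact: lt_trans.
rewrite U ge0_integral_setU//=; last 3 first.
- exact/measurable_funTS/measurable_EFinP.
- by move=> t _; rewrite lee_fin.
- apply/disj_setPS => t [] /=; rewrite !in_itv/= andbT => /andP[_ h1] h2.
  by move: (lt_le_trans h2 h1); rewrite ltxx.
rewrite (eq_integral (cst M%:E)); last first.
  by move=> t; rewrite inE/= in_itv/= => /andP[_ h]; rewrite /powR_tail h.
have -> : (\int[mu]_(t in `]1%R, +oo[) (powR_tail M c q t)%:E =
    \int[mu]_(t in `]1%R, +oo[) (c%:E * (t `^ (- q))%:E))%E.
  apply: eq_integral => t; rewrite inE/= in_itv/= andbT => h.
  by rewrite /powR_tail leNgt h EFinM.
rewrite integral_cst//= lebesgue_measure_itv/= lte01 oppr0 adde0 mule1.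
rewrite ge0_integralZl//; last 2 first.
- by apply/measurable_funTS/measurable_EFinP; exact: measurable_powR.
- by move=> t _; rewrite lee_fin powR_ge0.
rewrite integral_itv_obnd_cbnd; last first.
  by apply/measurable_funTS/measurable_EFinP; exact: measurable_powR.
pose F (t : R) := - (q - 1)^-1 * t `^ (- (q - 1)).
have dF (t : R) : 0 < t -> is_derive t 1 F (t `^ (- q)).
  move=> tp; have h := is_derive1_powR (- (q - 1)) tp.
  have -> : F = (- (q - 1)^-1) \*: (@powR R ^~ (- (q - 1))) by apply/funext => u.
  apply: is_derive_eq; rewrite /GRing.scale/= mulrA mulrNN mulVf ?gt_eqF// mul1r.
  by congr (_ `^ _); ring.
rewrite (@ge0_continuous_FTC2y _ (fun t => t `^ (- q)) F 1 0).
- by rewrite -EFinB -EFinM -EFinD ltry.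
- by move=> t _; exact: powR_ge0.
- apply: continuous_in_subspaceT => t; rewrite inE/= in_itv/= andbT => h.
  by apply: continuous_powR_gt0; exact: lt_le_trans h.
- have : F t @[t --> +oo] --> - (q - 1)^-1 * 0.
    by apply: cvgM; [exact: cvg_cst|exact: powR_cvg_y].
  by rewrite mulr0.
- by move=> t h; case: (dF _ (lt_trans ltr01 h)).
- apply: cvg_at_right_filter; apply/differentiable_continuous/derivable1_diffP.
  by case: (dF _ ltr01).
- move=> t; rewrite in_itv/= andbT => h; rewrite derive1E.
  by have := dF _ (lt_trans ltr01 h) => -[].
Qed.

(** The inequality [- w^2 <= 2 w + 1] at [w = y - a - m * rho] replaces the Gaussian decay by a
    geometric sequence in [m]. *)
Lemma cvg_normal_pdf_shift (a rho s y : R) : s != 0 -> 0 < rho ->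
  normal_pdf (a + m%:R * rho) s y @[m --> \oo] --> (0 : R).
Proof.
move=> s0 rho0; pose c := s ^+ 2 *+ 2.
have c0 : 0 < c by rewrite pmulrn_lgt0// exprn_even_gt0.
pose K := normal_peak s * expR ((2 * (y - a) + 1) / c).
pose e := expR (- (2 * rho / c)).
apply: (@squeeze_cvgr _ _ _ _ (fun=> 0) (fun m => K * e ^+ m)).
- apply: nearW => m; rewrite normal_pdf_ge0/= normal_pdfE//.
  rewrite /K -mulrA ler_wpM2l ?normal_peak_ge0// /e -expRM_natl -expRD ler_expR.
  rewrite -/c -mulr_natl mulrN mulrA -mulrBl ler_pM2r ?invr_gt0//.
  have := sqr_ge0 (y - (a + m%:R * rho) + 1); nra.
- exact: cvg_cst.
- have : K * e ^+ m @[m --> \oo] --> K * 0.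
    apply: cvgM; first exact: cvg_cst.
    apply: cvg_expr; rewrite ger0_norm ?expR_ge0// /e -[ltRHS]expR0 ltr_expR.
    by rewrite oppr_lt0 divr_gt0// mulr_gt0.
  by rewrite mulr0.
Qed.

(** [|t - 1|] is smaller than the larger of [t] and 1, and [u |-> u^(2H)] is increasing. *)
Lemma fbm_cov1_gt0 (H t : R) : 0 < H -> 0 < t -> 0 < fbm_cov H t 1.
Proof.
move=> H0 t0; rewrite /fbm_cov mulr_gt0// powR1 subr_gt0.
have H20 : 0 < 2 * H by rewrite mulr_gt0.
have lt_powR (u v : R) : 0 <= u -> u < v -> u `^ (2 * H) < v `^ (2 * H).
  by move=> u0 uv; apply: gt0_ltr_powR; rewrite ?nnegrE// ltW// (le_lt_trans u0).
have [t1|t1] := leP 1 t.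
  rewrite ger0_norm ?subr_ge0//.
  have : (t - 1) `^ (2 * H) < t `^ (2 * H) by apply: lt_powR; lra.
  lra.
rewrite ltr0_norm ?subr_lt0// opprB.
have : (1 - t) `^ (2 * H) < 1 `^ (2 * H) by apply: lt_powR; lra.
have := powR_gt0 (2 * H) t0; rewrite powR1; lra.
Qed.

Lemma lebesgue_rV_box n (y : 'rV[R]_n) (e : R) : 0 < e ->
  (0 < lebesgue_rV R n (cylinder (fun i => `](y ord0 i - e)%R, (y ord0 i + e)%R[%classic)))%E.
Proof.
move=> e0; pose A (i : 'I_n) := `](y ord0 i - e)%R, (y ord0 i + e)%R[%classic.
have mA i : measurable (A i) by exact: measurable_itv.
have -> : lebesgue_rV R n (cylinder A) = (\prod_(i < n) mu (A i))%E.
  exact: lebesgue_rV_prod.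
apply: (@big_ind _ (fun x => 0 < x)%E) => [|a b a0 b0|i _]; first exact: lte01.
  exact: mule_gt0.
rewrite lebesgue_measure_itv/= lte_fin.
have -> : y ord0 i - e < y ord0 i + e by lra.
by rewrite -EFinB lte_fin; lra.
Qed.

Lemma rV_set0_cylinder n : [set (0 : 'rV[R]_n)] = cylinder (fun=> [set 0]).
Proof.
apply/seteqP; split => [y -> i|y y0] /=; first by rewrite mxE.
by apply/rowP => i; rewrite mxE; exact: y0.
Qed.

Lemma measurable_rV_set0 n : measurable [set (0 : 'rV[R]_n)].
Proof. by rewrite rV_set0_cylinder; exact: measurable_cylinder. Qed.

Lemma lebesgue_rV_set0 n : lebesgue_rV R n.+1 [set 0] = 0%E.
Proof.
rewrite rV_set0_cylinder; pose A (i : 'I_n.+1) : set R := [set 0].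
have mA i : measurable (A i) by exact: measurable_set1.
by rewrite (lebesgue_rV_prod mA) big_ord_recl /A lebesgue_measure_set1 mul0e.
Qed.

(** Balls of the sup norm are boxes, whose measure is a product of positive lengths. *)
Lemma continuous_pos_measure n (f : 'rV[R]_n -> R) (y0 : 'rV[R]_n) :
  continuous f -> f y0 != 0 ->
  exists A, [/\ measurable A, (0 < lebesgue_rV R n A)%E & forall y, A y -> f y != 0].
Proof.
move=> cf fy0.
have : \forall y \near y0, f y != 0.
  exact: (@cvgr_neq0 _ R^o _ _ _ _ (f y0) (cf y0) fy0).
move=> /nbhs_ballP[e /= e0 he].
exists (cylinder (fun i => `](y0 ord0 i - e)%R, (y0 ord0 i + e)%R[%classic)); split.
- by apply: measurable_cylinder => i; exact: measurable_itv.
- exact: lebesgue_rV_box.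
- move=> y yA; apply: he; rewrite /ball/=; split=> // i j; rewrite ord1.
  have := yA j; rewrite /= in_itv/= /ball/= => /andP[h1 h2].
  by rewrite ltr_norml; apply/andP; split; lra.
Qed.

End domination.

(** * The perpetual integral *)

Section perpetual.
Context (R : realType) (disp : measure_display) (T : measurableType disp).
Variables (P : probability T R) (H : R) (n : nat) (x : 'rV[R]_n.+1).
Variables (B : R -> T -> 'rV[R]_n.+1) (f : 'rV[R]_n.+1 -> R) (M : R).
Hypotheses (H0 : 0 < H) (Hd : H^-1 < n.+1%:R).
Hypothesis fB : fractional_brownian_motion P H B.
Hypotheses (cf : continuous f) (fM : forall y, f y <= M) (f0 : forall y, 0 <= f y).
Hypothesis intf : (lebesgue_rV R n.+1).-integrable setT (EFin \o f).
Local Notation mu := (@lebesgue_measure R).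
Local Notation D := (`]0%R, +oo[%classic : set R).
Local Notation rho t := (fbm_cov H t 1).

(** Extended-real valued, so as to make sense before finiteness is known, and over the open
    half-line, because the density formulas for [B t] require [t > 0]. *)
Definition occupation (w : T) : \bar R :=
  (\int[mu]_(t in `]0%R, +oo[) (f (x + B t w))%:E)%E.

(* The mean of f (x + B t) under the probability with density tilt B lam. *)
Definition tilted_mean (lam t : R) : \bar R :=
  (\int[lebesgue_rV R n.+1]_y ((f y)%:E * (normal_rV_pdf
    (fun i => x ord0 i + lam * rho t * (i == ord0)%:R) (t `^ H) y)%:E))%E.

Let mf : measurable_fun setT f.
Proof. by apply/measurable_EFinP; case/integrableP: intf. Qed.

Let fB1 i : fractional_brownian_motion1 P H (fun t w => B t w ord0 i).
Proof. by case: fB => + _; apply. Qed.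

Let Y (p : T * R) : R := f (x + B (Num.max p.2 0) p.1).

Lemma measurable_fbm_path : measurable_fun setT (fun p : T * R => x + B (Num.max p.2 0) p.1).
Proof.
apply: measurable_fun_rVP => i; under eq_fun do rewrite mxE.
apply: measurable_funD => //.
have [_ _ _ cB] := fB1 i.
by apply: (measurable_continuous_process (X := fun t w => B t w ord0 i)) => // t;
  exact: (measurable_fbm (fB1 i)).
Qed.

Let mY : measurable_fun setT Y.
Proof. exact: (measurableT_comp mf measurable_fbm_path). Qed.

(** Integrated in time it gives the weighted occupation, integrated over [P] the tilted mean. The
    indicator of [D] lets Tonelli run over the full product space. *)
Let W (lam : R) (p : T * R) : \bar R := (Y p * tilt B lam p.1 * \1_D p.2)%:E.

Let W0 lam p : (0 <= W lam p)%E.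
Proof.
by rewrite lee_fin; apply: mulr_ge0 => //; apply: mulr_ge0; [exact: f0|exact: expR_ge0].
Qed.

Let mW lam : measurable_fun setT (W lam).
Proof.
apply/measurable_EFinP; apply: measurable_funM.
  apply: measurable_funM => //.
  by apply: (measurableT_comp (measurable_tilt fB lam)).
by apply: (@measurableT_comp _ _ _ _ _ _ (\1_D : R -> R)).
Qed.

Let W_D lam w t : t \in D -> W lam (w, t) = ((f (x + B t w))%:E * (tilt B lam w)%:E)%E.
Proof.
move=> tD; rewrite /W indicE/= tD mulr1 EFinM /Y/= max_l//.
by move: tD; rewrite inE/= in_itv/= andbT => /ltW.
Qed.

Let W_ND lam w t : t \notin D -> W lam (w, t) = 0%E.
Proof. by move=> tD; rewrite /W indicE/= (negbTE tD) mulr0. Qed.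

Let integral_W_time lam w :
  (\int[mu]_t W lam (w, t) = occupation w * (tilt B lam w)%:E)%E.
Proof.
rewrite /occupation -ge0_integralZr//.
- rewrite [RHS]integral_mkcond; apply: eq_integral => t _; rewrite patchE.
  by case: ifPn => tD; [exact: W_D|exact: W_ND].
- apply: (eq_measurable_fun (fun t => (Y (w, t))%:E)) => [t|].
    by rewrite inE/= in_itv/= andbT => t0; rewrite /Y/= max_l// ltW.
  apply: measurable_funTS; apply/measurable_EFinP.
  exact: (measurableT_comp mY (measurable_pair1 w)).
- by move=> t _; rewrite lee_fin.
- by rewrite lee_fin expR_ge0.
Qed.

Let integral_W_prob lam t :
  (\int[P]_w W lam (w, t) = ((tilted_mean lam) \_ D) t)%E.
Proof.
rewrite patchE; case: ifPn => tD; last first.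
  by rewrite integral0_eq// => w _; exact: W_ND.
rewrite /tilted_mean -(fbm_tilt_integral H0 fB).
- by apply: eq_integral => w _; exact: W_D.
- by move: tD; rewrite inE/= in_itv/= andbT.
- exact/measurable_EFinP.
- by move=> y; rewrite lee_fin.
Qed.

Lemma integral_occupation_tilt lam :
  (\int[P]_w (occupation w * (tilt B lam w)%:E) =
   \int[mu]_(t in `]0%R, +oo[) tilted_mean lam t)%E.
Proof.
under eq_integral do rewrite -integral_W_time.
rewrite (@fubini_tonelli _ _ _ _ _ P mu (W lam) (mW lam) (W0 lam)).
rewrite [RHS]integral_mkcond; apply: eq_integral => t _.
exact: integral_W_prob.
Qed.

Lemma measurable_tilted_mean lam : measurable_fun D (tilted_mean lam).
Proof.
apply/(measurable_restrictT (tilted_mean lam)) => //.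
have := @measurable_fun_fubini_tonelli_G _ _ _ _ _ P _ (mW lam) (W0 lam).
by congr (measurable_fun _ _); apply/funext => t; exact: integral_W_prob.
Qed.

Lemma tilt0 w : tilt B 0 w = 1.
Proof. by rewrite /tilt mul0r expr0n/= mul0r subr0 expR0. Qed.

Lemma integral_occupation :
  (\int[P]_w occupation w = \int[mu]_(t in `]0%R, +oo[) tilted_mean 0 t)%E.
Proof.
by rewrite -integral_occupation_tilt; apply: eq_integral => w _; rewrite tilt0 mule1.
Qed.

Lemma occupation_ge0 w : (0 <= occupation w)%E.
Proof. by apply: integral_ge0 => t _; rewrite lee_fin. Qed.

Lemma measurable_occupation : measurable_fun setT occupation.
Proof.
have := @measurable_fun_fubini_tonelli_F _ _ _ _ _ mu _ (mW 0) (W0 0).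
rewrite (_ : fubini_F _ _ = occupation)//; apply/funext => w.
by rewrite /fubini_F integral_W_time tilt0 mule1.
Qed.

Lemma tilted_mean_ge0 lam t : (0 <= tilted_mean lam t)%E.
Proof.
by apply: integral_ge0 => y _; rewrite mule_ge0// lee_fin ?normal_rV_pdf_ge0.
Qed.

Lemma integral_normal_rV_pdf k (m : 'I_k -> R) s :
  (\int[lebesgue_rV R k]_y (normal_rV_pdf m s y)%:E = 1)%E.
Proof.
have -> : setT = cylinder (fun=> setT) :> set 'rV[R]_k by apply/seteqP; split.
rewrite integral_normal_rV_pdf_cylinder// big1// => i _.
exact: (@probability_setT _ _ _ (normal_prob (m i) s)).
Qed.

Lemma normal_rV_pdf_ub k (m : 'I_k -> R) s y : s != 0 ->
  normal_rV_pdf m s y <= normal_peak s ^+ k.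
Proof.
move=> s0; rewrite -[k in leRHS]card_ord -prodr_const; apply: ler_prod => i _.
by rewrite normal_pdf_ge0 normal_pdf_ub.
Qed.

Let F1 := fine (\int[lebesgue_rV R n.+1]_y (f y)%:E)%E.
Let K : R := (2 * pi) `^ (- (n.+1%:R / 2)) * F1.

(** A normal density has mass 1 and a maximum independent of its centre, so the bound is uniform in
    [lam]: it yields finiteness at [lam = 0] and dominated convergence as [lam] grows. *)
Lemma tilted_mean_le lam t : 0 < t ->
  (tilted_mean lam t <= (powR_tail M K (n.+1%:R * H) t)%:E)%E.
Proof.
move=> t0; have tH0 : t `^ H != 0 by rewrite gt_eqF// powR_gt0.
rewrite /powR_tail; case: ifPn => _.
  rewrite /tilted_mean.
  pose m (i : 'I_n.+1) := x ord0 i + lam * rho t * (i == ord0)%:R.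
  apply: (@le_trans _ _ (\int[lebesgue_rV R n.+1]_y (M%:E * (normal_rV_pdf m (t `^ H) y)%:E))%E).
    apply: ge0_le_integral => //.
    - by move=> y _; rewrite mule_ge0// lee_fin ?normal_rV_pdf_ge0.
    - apply: emeasurable_funM; apply/measurable_EFinP => //; exact: measurable_normal_rV_pdf.
    - apply: emeasurable_funM; apply/measurable_EFinP => //; exact: measurable_normal_rV_pdf.
    - by move=> y _; rewrite lee_wpmul2r// lee_fin ?normal_rV_pdf_ge0.
  rewrite ge0_integralZl//.
  - by rewrite integral_normal_rV_pdf mule1.
  - by apply/measurable_EFinP; exact: measurable_normal_rV_pdf.
  - by move=> y _; rewrite lee_fin normal_rV_pdf_ge0.
  - by rewrite lee_fin (le_trans (f0 0)).
rewrite /K mulrAC -normal_peak_exp//.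
rewrite EFinM /F1 fineK; last exact: integrable_fin_num.
rewrite -ge0_integralZl//.
- apply: ge0_le_integral => //.
  + by move=> y _; rewrite mule_ge0// lee_fin ?normal_rV_pdf_ge0.
  + apply: emeasurable_funM; apply/measurable_EFinP => //; exact: measurable_normal_rV_pdf.
  + by apply: emeasurable_funM; apply/measurable_EFinP.
  + move=> y _; rewrite [leRHS]muleC lee_wpmul2l// lee_fin//.
    exact: normal_rV_pdf_ub.
- exact/measurable_EFinP.
- by move=> y _; rewrite lee_fin.
- by rewrite lee_fin exprn_ge0// normal_peak_ge0.
Qed.

Let dH1 : 1 < n.+1%:R * H.
Proof. by rewrite -ltr_pdivrMr// div1r. Qed.

Let tail_integrable :
  mu.-integrable `]0%R, +oo[ (fun t => (powR_tail M K (n.+1%:R * H) t)%:E).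
Proof.
apply: integrable_powR_tail => //; first exact: le_trans (f0 0) _.
rewrite mulr_ge0 ?powR_ge0// fine_ge0//; apply: integral_ge0 => y _.
by rewrite lee_fin.
Qed.

Lemma cvg_normal_rV_pdf_shift k (a : 'I_k.+1 -> R) (r s : R) y : s != 0 -> 0 < r ->
  normal_rV_pdf (fun i => a i + m%:R * r * (i == ord0)%:R) s y @[m --> \oo] --> (0 : R).
Proof.
move=> s0 r0; pose C := \prod_(i < k) normal_pdf (a (lift ord0 i)) s (y ord0 (lift ord0 i)).
have E m : normal_rV_pdf (fun i => a i + m%:R * r * (i == ord0)%:R) s y =
    normal_pdf (a ord0 + m%:R * r) s (y ord0 ord0) * C.
  rewrite /normal_rV_pdf big_ord_recl/= mulr1; congr (_ * _).
  by apply: eq_bigr => i _; rewrite mulr0 addr0.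
under eq_fun do rewrite E.
have : normal_pdf (a ord0 + m%:R * r) s (y ord0 ord0) * C @[m --> \oo] --> 0 * C.
  by apply: cvgM; [exact: cvg_normal_pdf_shift|exact: cvg_cst].
by rewrite mul0r.
Qed.

(** The density tends to 0 at each point as its centre escapes, and [f] times the maximum of the
    density dominates. *)
Lemma cvg_tilted_mean t : 0 < t -> tilted_mean m%:R t @[m --> \oo] --> 0%E.
Proof.
move=> t0; have tH0 : t `^ H != 0 by rewrite gt_eqF// powR_gt0.
pose h (m : nat) y := ((f y)%:E * (normal_rV_pdf
    (fun i => x ord0 i + m%:R * rho t * (i == ord0)%:R) (t `^ H) y)%:E)%E.
have [|||||_ _] := @dominated_convergence _ _ _ (lebesgue_rV R n.+1) _ measurableT
  h (cst 0%E) (fun y => (f y)%:E * (normal_peak (t `^ H) ^+ n.+1)%:E)%E.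
- by move=> m; apply: emeasurable_funM; apply/measurable_EFinP => //; exact: measurable_normal_rV_pdf.
- exact: measurable_cst.
- apply: aeW => y _; rewrite -[cst 0%E y]/((0 : R)%:E) /h.
  under eq_fun do rewrite -EFinM.
  apply: cvg_EFin; first exact: nearW.
  have : f y * normal_rV_pdf (fun i => x ord0 i + m%:R * rho t * (i == ord0)%:R)
      (t `^ H) y @[m --> \oo] --> f y * 0.
    apply: cvgM; first exact: cvg_cst.
    by apply: cvg_normal_rV_pdf_shift => //; exact: fbm_cov1_gt0.
  by rewrite mulr0.
- exact: integrableZr.
- apply: aeW => y m _; rewrite /h -EFinM gee0_abs; last first.
    by rewrite lee_fin mulr_ge0// normal_rV_pdf_ge0.
  by rewrite EFinM lee_wpmul2l// lee_fin// normal_rV_pdf_ub.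
by rewrite integral0.
Qed.

Lemma integral_occupation_lty : (\int[P]_w occupation w < +oo)%E.
Proof.
rewrite integral_occupation; have /integrableP[_] := tail_integrable.
apply: le_lt_trans; apply: ge0_le_integral => //.
- by move=> t _; exact: tilted_mean_ge0.
- exact: measurable_tilted_mean.
- apply: measurableT_comp => //; apply/measurable_funTS/measurable_EFinP.
  exact: measurable_powR_tail.
- move=> t; rewrite /= in_itv/= andbT => t0.
  by rewrite (le_trans (tilted_mean_le _ t0))// lee_fin ler_norm.
Qed.

Lemma integrable_occupation : P.-integrable setT occupation.
Proof.
apply/integrableP; split; first exact: measurable_occupation.
under eq_integral do rewrite gee0_abs ?occupation_ge0//.
exact: integral_occupation_lty.
Qed.

Lemma cvg_integral_tilted_mean :
  (\int[mu]_(t in `]0%R, +oo[) tilted_mean m%:R t)%E @[m --> \oo] --> 0%E.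
Proof.
have [] // := @dominated_convergence _ (measurableTypeR R) R mu `]0%R, +oo[%classic
  (measurable_itv _) (fun m => tilted_mean m%:R) (cst 0%E)
  (fun t => (powR_tail M K (n.+1%:R * H) t)%:E).
- by move=> m; exact: measurable_tilted_mean.
- by apply: aeW => t; rewrite /= in_itv/= andbT => t0; exact: cvg_tilted_mean.
- apply: aeW => t m; rewrite /= in_itv/= andbT => t0.
  by rewrite gee0_abs ?tilted_mean_ge0// tilted_mean_le.
by move=> _ _; rewrite integral0.
Qed.

(** The case [h = 1] of [fbm_tilt_integral]; time 1 is just some positive time. *)
Lemma integral_tilt lam : (\int[P]_w (tilt B lam w)%:E = 1)%E.
Proof.
have := @fbm_tilt_integral _ _ _ P _ _ _ H0 fB 1 lam 0 (cst 1%E) ltr01.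
under eq_integral do rewrite mul1e.
move=> ->//; under eq_integral do rewrite mul1e.
exact: integral_normal_rV_pdf.
Qed.

(* All tilts being probability densities, a constant occupation would be equal to
   its mean under each of them; these means tend to 0 as lam grows. *)
Lemma occupation_cst (c : \bar R) : {ae P, forall w, occupation w = c} ->
  (\int[P]_w occupation w = 0)%E.
Proof.
move=> Ic; have tilt_ge0 lam w : (0 <= (tilt B lam w)%:E)%E by rewrite lee_fin expR_ge0.
have mt lam : measurable_fun setT (fun w => (tilt B lam w)%:E).
  by apply/measurable_EFinP; exact: measurable_tilt fB _.
(* As [P] has mass 1, the almost sure equality holds at one point at least, and occupations are
   nonnegative. *)
have c0 : (0 <= c)%E.
  have [w <-] : exists w, occupation w = c; last exact: occupation_ge0.
  apply/not_existsP => nI; have [N [mN N0 sub]] := Ic.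
  have : P setT = 0%E.
    apply/eqP; rewrite eq_le measure_ge0 andbT -N0; apply: le_measure; rewrite ?inE//.
    by move=> w _; apply: sub; exact: nI.
  by rewrite probability_setT => /eqP; rewrite onee_eq0.
have Jc lam : (\int[mu]_(t in `]0%R, +oo[) tilted_mean lam t = c)%E.
  rewrite -integral_occupation_tilt.
  rewrite (ge0_ae_eq_integral (g := fun w => c * (tilt B lam w)%:E)%E)//.
  - by rewrite ge0_integralZl// integral_tilt mule1.
  - by apply: emeasurable_funM => //; exact: measurable_occupation.
  - exact: measurable_funeM.
  - by move=> w _; rewrite mule_ge0// occupation_ge0.
  - by move=> w _; rewrite mule_ge0.
  - by apply: filterS Ic => w -> _.
rewrite integral_occupation Jc; have := cvg_integral_tilted_mean.
under eq_fun do rewrite Jc.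
by move=> /cvg_lim <-//; apply/esym/cvg_lim => //; exact: cvg_cst.
Qed.

End perpetual.

(** * Positivity and closed form of the mean *)

Section perpetual_mean.
Context (R : realType) (disp : measure_display) (T : measurableType disp).
Variables (P : probability T R) (H : R) (n : nat) (x : 'rV[R]_n.+1).
Variables (B : R -> T -> 'rV[R]_n.+1) (f : 'rV[R]_n.+1 -> R) (M : R).
Hypotheses (H0 : 0 < H) (Hd : H^-1 < n.+1%:R).
Hypothesis fB : fractional_brownian_motion P H B.
Hypotheses (cf : continuous f) (fM : forall y, f y <= M) (f0 : forall y, 0 <= f y).
Hypothesis intf : (lebesgue_rV R n.+1).-integrable setT (EFin \o f).
Local Notation mu := (@lebesgue_measure R).
Local Notation lam := (lebesgue_rV R n.+1).
Local Notation D := (`]0%R, +oo[%classic : set R).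

Let mf : measurable_fun setT f.
Proof. by apply/measurable_EFinP; case/integrableP: intf. Qed.

Lemma normal_rV_pdf_gt0 k (m : 'I_k -> R) s y : s != 0 -> 0 < normal_rV_pdf m s y.
Proof.
move=> s0; apply: prodr_gt0 => i _; rewrite normal_pdfE// mulr_gt0 ?expR_gt0//.
exact: normal_peak_gt0.
Qed.

(** A zero mean would make the mean of [f (x + B t)] vanish at some time [t > 0]. There the density
    is positive everywhere, so [f] would vanish almost everywhere, although it is nonzero on a set
    of positive measure. *)
Lemma integral_occupation_neq0 : (exists y, f y != 0) ->
  (\int[P]_w occupation x B f w != 0)%E.
Proof.
move=> [y0 fy0]; apply/eqP => E0.
have mJ := measurable_tilted_mean x H0 fB f0 intf 0.
have J0 : ae_eq mu D (tilted_mean H x f 0) (cst 0%E).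
  apply/(ae_eq_integral_abs mu (measurable_itv _) mJ).
  under eq_integral do rewrite gee0_abs ?tilted_mean_ge0//.
  by rewrite -(integral_occupation x H0 fB f0 intf).
have [t [t0 Jt]] : exists t, 0 < t /\ tilted_mean H x f 0 t = 0%E.
  apply/not_existsP => nJ; have [N [mN N0 sub]] := J0.
  have : mu D = 0%E.
    apply/eqP; rewrite eq_le measure_ge0 andbT -N0; apply: le_measure; rewrite ?inE//.
    move=> t Dt; apply: sub => /= /(_ Dt) Jt; apply: (nJ t); split => //.
    by move: Dt; rewrite /= in_itv/= andbT.
  by rewrite lebesgue_measure_itv/= ltry => /eqP.
have tH0 : t `^ H != 0 by rewrite gt_eqF// powR_gt0.
pose m (i : 'I_n.+1) := x ord0 i + 0 * fbm_cov H t 1 * (i == ord0)%:R.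
have mg : measurable_fun setT (fun y => ((f y)%:E * (normal_rV_pdf m (t `^ H) y)%:E)%E).
  by apply: emeasurable_funM; apply/measurable_EFinP => //; exact: measurable_normal_rV_pdf.
have [A [mA A0 fA]] := continuous_pos_measure cf fy0.
have : ae_eq lam setT (fun y => (f y)%:E * (normal_rV_pdf m (t `^ H) y)%:E)%E (cst 0%E).
  apply/(ae_eq_integral_abs lam measurableT mg).
  under eq_integral do rewrite gee0_abs ?mule_ge0 ?lee_fin ?normal_rV_pdf_ge0//.
  exact: Jt.
move=> [N [mN N0 sub]].
suff : (lam A <= 0)%E by rewrite leNgt A0.
rewrite -N0; apply: le_measure; rewrite ?inE// => y Ay; apply: sub => /= /(_ I).
move=> /eqP; rewrite mule_eq0 !eqe (negbTE (fA _ Ay))/=.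
by rewrite gt_eqF// normal_rV_pdf_gt0.
Qed.

Lemma tilted_mean0 t : 0 < t ->
  (tilted_mean H x f 0 t = \int[lam]_y ((f (x + y))%:E * (gaussian_kernel H t y)%:E))%E.
Proof.
move=> t0; rewrite /tilted_mean.
rewrite -(ge0_integral_lebesgue_rV_shift x).
- apply: eq_integral => y _; rewrite -(normal_rV_pdf_kernel H x y t0).
  rewrite (_ : (fun i => x ord0 i + _) = (fun i => x ord0 i))//.
  by apply/funext => i; rewrite !mul0r addr0.
- by apply: emeasurable_funM; apply/measurable_EFinP => //; exact: measurable_normal_rV_pdf.
- by move=> y; rewrite mule_ge0// lee_fin ?normal_rV_pdf_ge0.
Qed.

(** Tonelli puts the time integral inside, where [integral_gaussian_kernel] computes it at every
    point but the origin, a null set in positive dimension. *)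
Lemma integral_occupation_kernel :
  (\int[P]_w occupation x B f w =
   (C_coef n.+1 H)%:E *
   \int[mu]_(u in `]0%R, +oo[) (u `^ (n.+1%:R / 2 - (2 * H)^-1 - 1) * expR (- u))%:E *
   \int[lam]_y (f (x + y) / euclid_norm y `^ (n.+1%:R - H^-1))%:E)%E.
Proof.
set G := (\int[mu]_(u in _) _)%E.
have G0 : (0 <= G)%E.
  by apply: integral_ge0 => u _; rewrite lee_fin mulr_ge0 ?powR_ge0 ?expR_ge0.
have C0 : 0 <= C_coef n.+1 H.
  by rewrite !mulr_ge0 ?powR_ge0// invr_ge0 ltW.
rewrite (integral_occupation x H0 fB f0 intf).
have mfx : measurable_fun setT (fun y => f (x + y)).
  exact: (measurableT_comp mf (measurable_addl_rV x)).
pose W (p : R * 'rV[R]_n.+1) := (f (x + p.2) * gaussian_kernel H p.1 p.2 * \1_D p.1)%:E.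
have W0 p : (0 <= W p)%E by rewrite lee_fin; apply: mulr_ge0 => //; apply: mulr_ge0; rewrite ?f0 ?gaussian_kernel_ge0.
have mW : measurable_fun setT W.
  apply/measurable_EFinP; apply: measurable_funM.
    apply: measurable_funM; last exact: measurable_gaussian_kernel.
    by apply: (measurableT_comp mfx).
  by apply: (@measurableT_comp _ _ _ _ _ _ (\1_D : R -> R)).
transitivity (\int[mu]_t \int[lam]_y W (t, y))%E.
  rewrite integral_mkcond; apply: eq_integral => t _; rewrite patchE.
  case: ifPn => tD; last first.
    by rewrite integral0_eq// => y _; rewrite /W indicE/= (negbTE tD) mulr0.
  rewrite tilted_mean0; last by move: tD; rewrite inE/= in_itv/= andbT.
  by apply: eq_integral => y _; rewrite /W indicE/= tD mulr1 EFinM.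
rewrite (@fubini_tonelli _ _ _ _ _ mu lam W mW W0).
have mq : measurable_fun setT (fun y => (f (x + y) / euclid_norm y `^ (n.+1%:R - H^-1))%:E).
  apply/measurable_EFinP; apply: measurable_funM => //.
  under eq_fun do rewrite -powRN.
  apply: (measurableT_comp (measurable_powR _)); exact: measurable_euclid_norm.
have q0 y : (0 <= (f (x + y) / euclid_norm y `^ (n.+1%:R - H^-1))%:E)%E.
  by rewrite lee_fin mulr_ge0// invr_ge0 powR_ge0.
rewrite -ge0_integralZl//; last by rewrite mule_ge0.
apply: ge0_ae_eq_integral => //.
- exact: (@measurable_fun_fubini_tonelli_G _ _ _ _ _ mu _ mW W0).
- exact: measurable_funeM.
- by move=> y _; apply: integral_ge0 => t _; exact: W0.
- by move=> y _; rewrite mule_ge0// mule_ge0.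
exists [set 0]; split; first exact: measurable_rV_set0.
  exact: lebesgue_rV_set0.
move=> y /= yW; apply: contrapT => y0; apply: yW => _.
have {}y0 : y != 0 by apply/eqP.
transitivity ((f (x + y))%:E * \int[mu]_(t in `]0%R, +oo[) (gaussian_kernel H t y)%:E)%E.
  rewrite -ge0_integralZl//.
  - rewrite /fubini_G [RHS]integral_mkcond; apply: eq_integral => t _; rewrite patchE.
    by rewrite /W indicE/=; case: ifPn => tD; rewrite ?mulr1 ?mulr0 ?EFinM.
  - apply: measurable_funTS; apply/measurable_EFinP.
    exact: (measurableT_comp (@measurable_gaussian_kernel R n.+1 H) (measurable_pair2 y)).
  - by move=> t _; rewrite lee_fin gaussian_kernel_ge0.
  - by rewrite lee_fin.
rewrite integral_gaussian_kernel// -/G muleA -EFinM muleAC -EFinM.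
by congr (_%:E * _)%E; ring.
Qed.

End perpetual_mean.

(** * The real-valued perpetual integral *)

Section perpetual_integral.
Context (R : realType) (disp : measure_display) (T : measurableType disp).
Variables (P : probability T R) (H : R) (n : nat) (x : 'rV[R]_n.+1).
Variables (B : R -> T -> 'rV[R]_n.+1) (f : 'rV[R]_n.+1 -> R) (M : R).
Hypotheses (H0 : 0 < H) (Hd : H^-1 < n.+1%:R).
Hypothesis fB : fractional_brownian_motion P H B.
Hypotheses (cf : continuous f) (fM : forall y, f y <= M) (f0 : forall y, 0 <= f y).
Hypothesis intf : (lebesgue_rV R n.+1).-integrable setT (EFin \o f).
Local Notation mu := (@lebesgue_measure R).
Local Notation I := (perpetual_integral f x B).

Let mf : measurable_fun setT f.
Proof. by apply/measurable_EFinP; case/integrableP: intf. Qed.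

Lemma measurable_along_path w : 
  measurable_fun (`[0%R, +oo[%classic : set R) (fun t => (f (x + B t w))%:E).
Proof.
apply: (@eq_measurable_fun _ _ (measurableTypeR R) (\bar R) _
    (fun t => (f (x + B (Num.max t 0) w))%:E)) => [t|].
  by rewrite inE/= in_itv/= andbT => t0; rewrite max_l.
apply: measurable_funTS; apply/measurable_EFinP.
have mY := measurableT_comp mf (measurable_fbm_path x fB).
exact: (measurableT_comp mY (measurable_pair1 w)).
Qed.

Lemma occupation_cbnd w :
  (\int[mu]_(t in `[0%R, +oo[) (f (x + B t w))%:E = occupation x B f w)%E.
Proof.
rewrite -integral_itv_obnd_cbnd//.
apply: measurable_funS (measurable_along_path w) => //.
by apply: subset_itvr; rewrite bnd_simp.
Qed.

Lemma perpetual_integralE w : I w = fine (occupation x B f w).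
Proof. by rewrite -occupation_cbnd. Qed.

Lemma measurable_perpetual_integral : measurable_fun setT I.
Proof.
rewrite (_ : I = fine \o occupation x B f); last exact/funext/perpetual_integralE.
apply: measurableT_comp; last exact: (measurable_occupation x fB f0 intf).
exact: fine_measurable.
Qed.

(** [I] takes its default value 0 where the occupation is infinite; the finite mean confines this to
    a null set. *)
Lemma perpetual_integral_fin :
  {ae P, forall w, (I w)%:E = occupation x B f w}.
Proof.
have := integrable_ae measurableT (integrable_occupation x H0 Hd fB fM f0 intf).
by apply: filterS => w /(_ Logic.I) occ_fin; rewrite perpetual_integralE fineK.
Qed.

Lemma ae_integrable_along_path :
  {ae P, forall w, mu.-integrable `[0, +oo[ (fun t => (f (x + B t w))%:E)}.
Proof.
have := integrable_ae measurableT (integrable_occupation x H0 Hd fB fM f0 intf).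
apply: filterS => w /(_ Logic.I) occ_fin.
apply/integrableP; split; first exact: measurable_along_path.
under eq_integral do rewrite gee0_abs ?lee_fin//.
by rewrite occupation_cbnd ltey_eq occ_fin.
Qed.

Lemma perpetual_integral_ge0 w : 0 <= I w.
Proof. by rewrite perpetual_integralE fine_ge0// occupation_ge0. Qed.

Lemma integral_perpetual_integral :
  (\int[P]_w (I w)%:E = \int[P]_w occupation x B f w)%E.
Proof.
apply: ae_eq_integral => //.
- by apply/measurable_EFinP; exact: measurable_perpetual_integral.
- exact: (measurable_occupation x fB f0 intf).
- by apply: filterS perpetual_integral_fin => w + _.
Qed.

Lemma integrable_perpetual_integral : P.-integrable setT (EFin \o I).
Proof.
apply/integrableP; split.
  by apply/measurable_EFinP; exact: measurable_perpetual_integral.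
under eq_integral do rewrite /= ger0_norm ?perpetual_integral_ge0//.
rewrite integral_perpetual_integral.
exact: (integral_occupation_lty x H0 Hd fB fM f0 intf).
Qed.

Lemma perpetual_integral_not_cst (c : R) : (exists y, f y != 0) ->
  ~ {ae P, forall w, I w = c}.
Proof.
move=> fn0 Ic; have /eqP := integral_occupation_neq0 x H0 fB cf f0 intf fn0; apply.
apply: (occupation_cst H0 Hd fB fM f0 intf (c := c%:E)).
by apply: filterS2 perpetual_integral_fin Ic => w <- ->.
Qed.

Lemma expectation_perpetual_integral :
  ('E_P[I] = (C_const n.+1 H)%:E *
    \int[lebesgue_rV R n.+1]_y
      (f (x + y) / euclid_norm y `^ (n.+1%:R - H^-1))%:E)%E.
Proof.
rewrite unlock integral_perpetual_integral.
(* For [f = 0] both sides vanish. This case is set apart because the finiteness of [G] is deduced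
   from a nonzero mean. *)
have [fn0|f_eq0] := pselect (exists y, f y != 0); last first.
  have {}f_eq0 y : f y = 0 by apply: contrapT => /eqP fy; apply: f_eq0; exists y.
  rewrite !integral0_eq ?mule0// => [y|w] _; first by rewrite f_eq0 mul0r.
  by apply: integral0_eq => t _; rewrite f_eq0.
have occ_neq0 := integral_occupation_neq0 x H0 fB cf f0 intf fn0.
have occ_lty := integral_occupation_lty x H0 Hd fB fM f0 intf.
have occE := integral_occupation_kernel x H0 fB f0 intf.
set E := (\int[P]_w occupation x B f w)%E in occ_neq0 occ_lty occE *.
set J := (\int[lebesgue_rV R n.+1]_y _)%E in occE *.
set G := (\int[mu]_(u in _) _)%E in occE.
have G0 : (0 <= G)%E.
  by apply: integral_ge0 => u _; rewrite lee_fin mulr_ge0 ?powR_ge0 ?expR_ge0.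
have J0 : (0 <= J)%E.
  by apply: integral_ge0 => y _; rewrite lee_fin mulr_ge0// invr_ge0 powR_ge0.
have C_gt0 : 0 < C_coef n.+1 H.
  by rewrite !mulr_gt0 ?powR_gt0 ?invr_gt0 ?pi_gt0.
(* An infinite [G] would make the mean 0 or infinite, according to whether [J] is 0 or positive;
   both are excluded. *)
have Gfin : G \is a fin_num.
  rewrite ge0_fin_numE// ltNge leye_eq; apply/eqP => Goo.
  move: occ_neq0 occ_lty; rewrite occE Goo gt0_muley ?lte_fin//.
  move: J0; rewrite le_eqVlt => /orP[/eqP <-|J_gt0]; first by rewrite mule0 eqxx.
  by rewrite gt0_mulye// ltxx.
by rewrite occE -[C_const _ _]/(C_coef n.+1 H * fine G) [in RHS]EFinM fineK.
Qed.

Lemma variance_perpetual_integral_gt0 : (exists y, f y != 0) -> (0 < 'V_P[I])%E.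
Proof.
move=> fn0; rewrite lt_neqAle variance_ge0 andbT; apply/eqP => /esym V0.
pose m := fine (\int[P]_w (I w)%:E)%E.
apply: (perpetual_integral_not_cst (c := m) fn0).
have mD : measurable_fun setT (fun w => (((I w - m) * (I w - m))%:E)).
  by apply/measurable_EFinP; apply: measurable_funM; apply: measurable_funB => //;
    exact: measurable_perpetual_integral.
(* A zero variance is a zero integral of a nonnegative function, which therefore vanishes almost
   surely. *)
have : ae_eq P setT (fun w => ((I w - m) * (I w - m))%:E) (cst 0%E).
  apply/(ae_eq_integral_abs P measurableT mD).
  rewrite -V0 /variance unlock /covariance.body unlock; apply: eq_integral => w _.
  by rewrite gee0_abs// lee_fin -expr2 sqr_ge0.
apply: filterS => w /(_ Logic.I) [] /eqP.
by rewrite mulf_eq0 orbb subr_eq0 => /eqP.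
Qed.

End perpetual_integral.

Theorem theorem2 (R : realType) (disp : measure_display)
    (T : measurableType disp) (P : probability T R)
    (H : R) (d : nat) (x : 'rV[R]_d) (B : R -> T -> 'rV[R]_d)
    (f : 'rV[R]_d -> R) :
  0 < H < 1 ->
  H^-1 < d%:R ->
  fractional_brownian_motion P H B ->
  CL f ->
  (forall y, 0 <= f y) ->
  let I : T -> R := perpetual_integral f x B in
  [/\ {ae P, forall w, lebesgue_measure.-integrable `[0, +oo[
                         (fun t => (f (x + B t w))%:E)},
      measurable_fun setT I,
      P.-integrable setT (EFin \o I),
      'E_P[I]%E = ((C_const d H)%:E *
        \int[lebesgue_rV R d]_y
          (f (x + y) / euclid_norm y `^ (d%:R - H^-1))%:E)%E &
      (exists y, f y != 0) ->
        (forall c : R, ~ {ae P, forall w, I w = c}) /\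
        (0 < 'V_P[I])%E].
Proof.
move=> /andP[H0 _] Hd fB [cf bf intf] f0 I.
case: d => [|n] in x B f Hd fB cf bf intf f0 I *.
  (* Dimension 0 would mean [1/H < 0]. *)
  by move: Hd; rewrite ltNge invr_ge0 ltW.
have [M fM] : exists M, forall y, f y <= M.
  (* [bounded_fun] makes every number above [M0] a bound, hence the choice [M0 + 1]. *)
  have [M0 [_ hM]] := bf; exists (M0 + 1) => y.
  by rewrite (le_trans (ler_norm _))// hM//= ltrDl.
split.
- exact: (ae_integrable_along_path x H0 Hd fB fM f0 intf).
- exact: (measurable_perpetual_integral x fB f0 intf).
- exact: (integrable_perpetual_integral x H0 Hd fB fM f0 intf).
- exact: (expectation_perpetual_integral x H0 Hd fB cf fM f0 intf).
- move=> fn0; split=> [c|].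
    exact: (perpetual_integral_not_cst H0 Hd fB cf fM f0 intf).
  exact: (variance_perpetual_integral_gt0 x H0 Hd fB cf fM f0 intf).
Qed.
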